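(* Assume the minimal $T_{CH}$-invariant set $M=M_{CH}^{T}$ has nonempty interior. Any local arc of $\partial M$ is a locally strictly convex real-analytic curve. Its orientation (given by $R(z)\partial_z$) coincides with the standard topological orientation of $\partial M$ if it is contained in $\mathfrak I^{+}$, and with the opposite orientation otherwise.
   Context: Setup. $P,Q\in\mathbb C[z]$ are not identically zero and not both constant, $T=Q(z)\frac{d}{dz}+P(z)$, $R=Q/P$, and $\mathcal Z(PQ)$ is the set of roots of $PQ$. A closed set $S\subset\mathbb C$ is $T_{CH}$-invariant if for every $u\in S$ and every real $t\ge 0$ the image $T(f)$ of $f(z)=(z-u)^t$ either has all its roots in $S$ or vanishes identically. There is a unique minimal (for inclusion) nonempty $T_{CH}$-invariant set, denoted $M=M_{CH}^{T}$. For $PQ(z)\ne0$ the associated ray is the half-line $r(z)=\{z+tR(z): t\in\mathbb R^+\}$. (Known equivalent characterization: a closed $S$ is $T_{CH}$-invariant iff $\mathcal Z(PQ)\subset S$ and $r(z)\cap S=\emptyset$ for every $z\notin S$.) $\mathfrak I_R$ (curve of inflections) is the closure in $\mathbb C$ of $\{z:\operatorname{Im}R'(z)=0\}$; $\mathfrak I^{+}=\{\operatorname{Im}R'>0\}$, $\mathfrak I^{-}=\{\operatorname{Im}R'<0\}$. $\mathbb C\cup\mathbb S^1$ is the compactification of $\mathbb C$ by the circle of directions: basic neighborhoods of $\theta\in\mathbb S^1$ are $I\cup C(z,I)$ with $I\ni\theta$ an open interval of $\mathbb S^1$ and $C(z,I)$ the open cone with apex $z$ and interval of directions $I$. Bars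 denote closures in $\mathbb C\cup\mathbb S^1$. For $z\in\partial M\setminus\mathcal Z(PQ)$: $\Gamma(z)=(\gamma_z^+\setminus\{z\})\cap\overline M$, where $\gamma_z^+$ is the positive trajectory of $R(z)\partial_z$ starting at $z$; $\Delta(z)=(\overline{r(z)}\setminus\{z\})\cap\overline M$. A point $z\in\partial M\setminus(\mathcal Z(PQ)\cup\mathfrak I_R)$ is a local point if $\Gamma(z)\neq\emptyset$ and $\Delta(z)=\emptyset$. A local arc of $\partial M$ is a maximal open arc of an integral curve of $R(z)\partial_z$ contained in $\partial M$ and containing only local points; it is oriented by $R(z)\partial_z$. The standard topological orientation of $\partial M$ is the one with $M$ on the left. *)

(* Defs.v *)
From HB Require Import structures.
From mathcomp Require Import all_boot all_order all_algebra complex.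
From mathcomp Require Import all_classical all_reals all_analysis.

Set Implicit Arguments.
Unset Strict Implicit.
Unset Printing Implicit Defensive.

Import Order.TTheory GRing.Theory Num.Theory.
Import numFieldNormedType.Exports.

Local Open Scope classical_set_scope.
Local Open Scope ring_scope.
Local Open Scope complex_scope.

(* The usual topology and norm on the complex numbers [R[i]], regarded as a
   normed module over itself; [derive1] is then the complex derivative. *)
HB.instance Definition _ (R : realType) := NormedModule.copy R[i] R[i]^o.

Definition boundary (T : topologicalType) (A : set T) : set T :=
  closure A `\` interior A.

Section Invariance.
Context {R : realType}.
Implicit Types (P Q : {poly R[i]}) (S M : set R[i]) (u z : R[i]).

Definition cexp (z : R[i]) : R[i] :=
  (expR (complex.Re z))%:C * (cos (complex.Im z) +i* sin (complex.Im z)).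

(* [f] coincides near [z] with exp(t log(w - u)) for some continuous
   determination [L] of log(w - u). *)
Definition power_branch u (t : R) z (f : R[i] -> R[i]) : Prop :=
  exists L : R[i] -> R[i], \forall w \near z,
    [/\ L @ w --> L w, cexp (L w) = w - u & f w = cexp (t%:C * L w)].

Definition Top P Q (f : R[i] -> R[i]) : R[i] -> R[i] :=
  fun z => Q.[z] * derive1 f z + P.[z] * f z.

(* (z - u)^t is multivalued in general. Away from [u] its branches near a point
   differ by a nonzero constant factor, so the roots of its image under [Top]
   do not depend on the branch. The point [u] itself is left out: it is only
   asked whether the roots lie in a set that already contains [u]. *)
Definition image_root P Q u (t : R) z : Prop :=
  z != u /\ exists2 f, power_branch u t z f & Top P Q f z = 0.

Definition TCH_invariant P Q S : Prop :=
  closed S /\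
  forall u, S u -> forall t : R, 0 <= t ->
    (forall z, image_root P Q u t z -> S z) \/
    (forall z, z != u -> image_root P Q u t z).

Definition minimal_TCH_invariant P Q M : Prop :=
  [/\ TCH_invariant P Q M, M !=set0 &
      forall S, TCH_invariant P Q S -> S !=set0 -> S `<=` M -> S = M].

End Invariance.

Section RationalField.
Context {R : realType}.
Implicit Types (P Q : {poly R[i]}) (z : R[i]).

Definition zeros P Q : set R[i] := [set z | root (P * Q) z].

(* The rational function Q/P in lowest terms: a common root of P and Q at which
   the quotient extends holomorphically is not a pole. *)
Definition pole P Q z : bool := root (P %/ gcdp P Q) z.
Definition ratfun P Q z : R[i] :=
  (Q %/ gcdp P Q).[z] / (P %/ gcdp P Q).[z].

Definition ray P Q z : set R[i] :=
  [set z + t%:C * ratfun P Q z | t in [set t : R | 0 <= t]].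

Definition inflection_curve P Q : set R[i] :=
  closure [set z | ~~ pole P Q z /\ complex.Im (derive1 (ratfun P Q) z) = 0].

Definition inflection_pos P Q : set R[i] :=
  [set z | ~~ pole P Q z /\ 0 < complex.Im (derive1 (ratfun P Q) z)].

Definition has_velocity (c : R -> R[i]) (t : R) (v : R[i]) : Prop :=
  is_derive t (1 : R) (fun s => complex.Re (c s)) (complex.Re v) /\
  is_derive t (1 : R) (fun s => complex.Im (c s)) (complex.Im v).

Definition open_interval (J : set R) : Prop :=
  [/\ J !=set0, open J & is_interval J].

Definition integral_curve P Q (J : set R) (c : R -> R[i]) : Prop :=
  forall t, J t -> ~~ pole P Q (c t) /\ has_velocity c t (ratfun P Q (c t)).

Definition positive_trajectory P Q z : set R[i] :=
  [set w | exists J c, [/\ open_interval J, J 0, c 0 = z, integral_curve P Q J c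
                         & exists s, [/\ J s, 0 <= s & w = c s]]].

End RationalField.

Definition circle (R : realType) := {theta : R[i] | `|theta| == 1}.
Definition compactified (R : realType) := (R[i] + circle R)%type.

Section Compactification.
Context {R : realType}.

Definition finite_point (z : R[i]) : compactified R := inl z.
Definition direction (theta : circle R) : compactified R := inr theta.

Definition circle_interval (I : set (circle R)) : Prop :=
  exists a b : R, [/\ a < b, b <= a + 2 * pi &
    I = [set theta | exists2 s, a < s < b & val theta = cos s +i* sin s]].

Definition cone (z : R[i]) (I : set (circle R)) : set R[i] :=
  [set w | exists t theta, [/\ 0 < t, I theta & w = z + t%:C * val theta]].

(* Finite intersections of the sets of the second kind that contain a given
   direction contain another such set, so this subbase generates the topology
   in which they are the basic neighborhoods of directions. *)
Definition compactified_subbase : set (set (compactified R)) :=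
  [set finite_point @` U | U in [set U | open U]] `|`
  [set V | exists z I, circle_interval I /\
           V = (direction @` I) `|` (finite_point @` cone z I)].

HB.instance Definition _ := Choice.on (compactified R).
HB.instance Definition _ :=
  isSubBaseTopological.Build (compactified R) compactified_subbase id.

Definition cclosure (A : set R[i]) : set (compactified R) :=
  closure (finite_point @` A).

End Compactification.

Section LocalArcs.
Context {R : realType}.
Implicit Types (P Q : {poly R[i]}) (M A : set R[i]) (z : R[i]).

Definition Gamma P Q M z : set (compactified R) :=
  (finite_point @` (positive_trajectory P Q z `\ z)) `&` cclosure M.

Definition Delta P Q M z : set (compactified R) :=
  (cclosure (ray P Q z) `\ finite_point z) `&` cclosure M.

Definition local_point P Q M z : Prop :=
  [/\ boundary M z, ~ (zeros P Q `|` inflection_curve P Q) z,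
      Gamma P Q M z !=set0 & Delta P Q M z = set0].

Definition integral_arc P Q A : Prop :=
  exists J (c : R -> R[i]),
    [/\ open_interval J, integral_curve P Q J c, {in J &, injective c}
      & A = c @` J].

Definition arc_of_local_points P Q M A : Prop :=
  [/\ integral_arc P Q A, A `<=` boundary M & A `<=` local_point P Q M].

Definition local_arc P Q M A : Prop :=
  arc_of_local_points P Q M A /\
  forall B, arc_of_local_points P Q M B -> A `<=` B -> B = A.

End LocalArcs.

Section PlaneCurves.
Context {R : realType}.
Implicit Types (A M U : set R[i]).

Definition real_analytic_at (c : R -> R[i]) (t0 : R) : Prop :=
  exists a : nat -> R[i], \forall t \near t0,
    series (fun k => a k * ((t - t0)%:C) ^+ k) @ \oo --> c t.

Definition real_analytic_curve A : Prop :=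
  exists J (c : R -> R[i]),
    [/\ open_interval J, {in J &, injective c}, A = c @` J
      & forall t, J t -> real_analytic_at c t /\
                         exists2 v, v != 0 & has_velocity c t v].

Definition dot (z w : R[i]) : R :=
  complex.Re z * complex.Re w + complex.Im z * complex.Im w.

(* Through every point of the curve there is a line meeting the curve at that
   point only and leaving the rest of the curve on one side. *)
Definition strictly_convex_curve A : Prop :=
  forall p, A p -> exists2 n : R[i], n != 0 &
    forall q, A q -> q != p -> 0 < dot n (q - p).

Definition locally_strictly_convex_curve A : Prop :=
  forall z, A z -> exists2 U, nbhs z U & strictly_convex_curve (A `&` U).

(* [v] is a tangent field of [A] giving its orientation. In the coordinates
   (x, y) of the positively oriented frame (v z, i * v z) at a point z of A, the
   arc is locally the graph of a continuous function and M is what lies on or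
   above it, i.e. to the left of A. *)
Definition has_on_left M A (v : R[i] -> R[i]) : Prop :=
  forall z, A z -> exists (e d : R) (g : R -> R),
    [/\ 0 < e, 0 < d, forall x, `|x| < e -> {for x, continuous g}
      & forall x y, `|x| < e -> `|y| < d ->
          let w := z + v z * (x +i* y) in
          (A w <-> y = g x) /\ (M w <-> g x <= y)].

End PlaneCurves.

(* Main.v *)
Require Import Defs.
From mathcomp Require Import all_boot all_order all_algebra complex.
From mathcomp Require Import all_classical all_reals all_analysis.
From mathcomp Require Import ring lra.
Import Order.TTheory GRing.Theory Num.Theory.
Import numFieldNormedType.Exports.
Local Open Scope classical_set_scope.
Local Open Scope ring_scope.
Local Open Scope complex_scope.

(** Write [R = Q / P], and call [z + r R(z)], [r >= 0], the ray of [z].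

    Invariance enters through one property only: the ray of a point outside
    [M] avoids [M] ([ray_misses_invariant]). Indeed [z <> u] is a root of the
    image of [(z - u)^t] exactly when [t Q(z) + P(z) (z - u) = 0]
    ([image_rootP]), that is, when [u] lies on the ray of [z] at parameter [t].
    The exceptional case of an identically vanishing image means that [R] is
    [(u - z) / t]; then [R'] is real everywhere ([pencil_slope]), all points
    lie on the curve of inflections and no point is local.

    Let [c] parametrize the arc, [c' = R(c)]. Then [c'' = R'(c) c'], so that
    the curvature of the arc has the sign of [Im R'], which does not vanish at
    local points and is therefore constant along the arc
    ([arc_turning_sign]). In the frame at a point of the arc given by [R],
    reflected in the real axis when [Im R' < 0], the arc is thus the graph of a
    strictly convex function [g] run through to the right
    ([turning_arc_convex]). Near that point, [M] is exactly the epigraph of [g]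
    ([convex_arc_epigraph]):
    - a point just below the graph lies on a tangent half-line that touches
      the arc further to the left; this half-line is the ray of a local point,
      so it meets [M] at its origin only;
    - the ray of a point just above the graph starts almost parallel to the
      arc, hence runs into the graph, which is contained in [M]; so the point
      cannot be outside [M].
    This gives both orientations. It also shows that the part of [M] above the
    graph is interior, so that near the chosen point the arc, being made of
    boundary points, is the graph and nothing else ([arc_local_structure]);
    its strict convexity follows.

    Analyticity is a property of all integral curves ([flow_analytic]). With
    [R = n / d] in lowest terms, the [k]-th derivative of [c] is
    [g_k(c) / d(c)^(2k)] for polynomials [g_k] obtained from each other by
    [g_(k+1) = n (g_k' d - 2 k g_k d')]. In a weighted l1 norm on coefficients,
    which is submultiplicative, differentiation costs at most a factor equal
    to the degree, and the degree of [g_k] grows linearly. Hence the [k]-th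
    derivative is at most [rho L^k k!], and the Taylor series converges to
    [c]. *)

Set Implicit Arguments.
Unset Strict Implicit.
Unset Printing Implicit Defensive.

Import complex.ComplexField.Normc.

(** * Convex graphs in the real plane *)

Lemma zero_between {R : realType} (f : R -> R) (a b : R) :
  a <= b -> (forall x, a <= x <= b -> {for x, continuous f}) ->
  f a * f b < 0 -> exists2 c, a < c < b & f c = 0.
Proof.
move=> ab fc fab.
have fc' : {within `[a, b], continuous f}.
  by apply: continuous_subspace_itv => x; rewrite in_itv /=; exact: fc.
have [|c cab fc0] := @IVT R f a b 0 ab fc'.
  by rewrite ge_min le_max; nra.
have cane t : f t != 0 -> c != t by apply: contraNneq => <-; apply/eqP.
exists c => //; move: cab; rewrite in_itv /= !le_eqVlt.
rewrite [a == c]eq_sym !(negPf (cane _ _))//; apply/eqP; nra.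
Qed.

Lemma small_factor {R : realType} (K D : R) : 0 <= K -> 0 < D ->
  exists2 d, 0 < d & K * d < D.
Proof.
move=> K0 D0; exists (D / (K + 1)); first by rewrite divr_gt0//; lra.
by rewrite mulrA ltr_pdivrMr; nra.
Qed.

Lemma point_on_line {K : fieldType} (u v a b x y : K) :
  u != 0 -> u * (y - b) - v * (x - a) = 0 -> b + (x - a) / u * v = y.
Proof.
move=> u0 /eqP; rewrite subr_eq0 => /eqP uv.
by rewrite mulrAC [_ * v]mulrC -uv mulrAC mulfV// mul1r addrC subrK.
Qed.

Lemma linear_positive_near_origin {R : realType} (A B D : R) : 0 < D ->
  exists2 d, 0 < d & forall x y, `|x| < d -> `|y| < d -> 0 < D + A * y - B * x.
Proof.
move=> D0; have [d d0 dD] := small_factor (addr_ge0 (normr_ge0 A) (normr_ge0 B)) D0.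
exists d => // x y xd yd.
have : `|A * y - B * x| <= (`|A| + `|B|) * d.
  rewrite (le_trans (ler_normB _ _))// !normrM mulrDl.
  by rewrite lerD// ler_wpM2l// ltW.
by rewrite ler_norml => /andP[+ _]; lra.
Qed.

(** A half-line that starts near the origin in an almost horizontal direction
    [(v1, v2)] passes below the point [(Xa, Ya)] of the upper right quadrant:
    the sign of the determinant tells on which side it passes. *)
Lemma secant_positive_near_horizontal {R : realType} (Xa Ya : R) :
  0 < Xa -> 0 < Ya -> exists e d, [/\ 0 < e, 0 < d &
    forall v1 v2 x y, `|v1 - 1| < e -> `|v2| < e -> `|x| < d -> `|y| < d ->
      0 < v1 /\ 0 < v1 * (Ya - y) - v2 * (Xa - x)].
Proof.
move=> Xa0 Ya0; have K0 : 0 <= Xa + 1 by lra.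
have Y40 : 0 < Ya / 4 by lra.
have [e e0 eY] := small_factor K0 Y40.
exists (Num.min (1 / 2) e), (Num.min 1 (Ya / 4)); split.
- by rewrite lt_min e0 andbT; lra.
- by rewrite lt_min Y40 ltr01.
move=> v1 v2 x y; rewrite !lt_min => /andP[v1h _] /andP[_ v2e].
move=> /andP[x1 _] /andP[_ yY].
have h2 : v2 * (Xa - x) <= e * (Xa + 1).
  rewrite (le_trans (ler_norm _))// normrM ler_pM//; first exact: ltW.
  by move: x1; rewrite ltr_norml ler_norml => /andP[? ?]; apply/andP; split; lra.
move: v1h yY; rewrite !ltr_norml => /andP[? ?] /andP[? ?].
split; first by lra.
have : 1 / 2 * (Ya * (3 / 4)) <= v1 * (Ya - y) by rewrite ler_pM//; lra.
lra.
Qed.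

(** The graph traced by [(X, Y)] is horizontal at the origin and lies above its
    tangents. The two determinants [X' s * (y - Y s) - Y' s * (x - X s)] and
    [V1 x y * (Y t - y) - V2 x y * (X t - x)] vanish when [(x, y)] is on the
    tangent at [s], respectively when the half-line of direction [(V1, V2)]
    from [(x, y)] goes through the point of parameter [t]. Each of them changes
    sign between the abscissa [x] and one end of the arc, which yields a
    tangent through every point just below the graph and a hitting point of
    the half-line of every point just above it. *)
Lemma convex_arc_epigraph {R : realType} (M : R -> R -> Prop)
    (X Y X' Y' : R -> R) (V1 V2 : R -> R -> R) (tau : R) :
  0 < tau ->
  (forall s, `|s| < tau -> [/\ {for s, continuous X}, {for s, continuous Y},
      {for s, continuous X'} & {for s, continuous Y'}]) ->
  (forall s, `|s| < tau -> 0 < X' s) ->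
  (forall s t, `|s| < tau -> `|t| < tau -> s < t -> X s < X t) ->
  (forall s t, `|s| < tau -> `|t| < tau -> s != t ->
     0 < X' s * (Y t - Y s) - Y' s * (X t - X s)) ->
  [/\ X 0 = 0, Y 0 = 0 & Y' 0 = 0] ->
  (forall s, `|s| < tau -> M (X s) (Y s)) ->
  (forall s r, `|s| < tau -> 0 < r -> ~ M (X s + r * X' s) (Y s + r * Y' s)) ->
  (exists2 d, 0 < d & forall x y, `|x| < d -> `|y| < d -> ~ M x y ->
     forall r, 0 <= r -> ~ M (x + r * V1 x y) (y + r * V2 x y)) ->
  (forall e, 0 < e -> exists2 d, 0 < d & forall x y, `|x| < d -> `|y| < d ->
     `|V1 x y - 1| < e /\ `|V2 x y| < e) ->
  exists e d (g : R -> R),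
    [/\ 0 < e, 0 < d, forall x, `|x| < e -> {for x, continuous g},
      forall x, `|x| < e -> exists s, [/\ `|s| < tau, X s = x & Y s = g x]
    & forall x y, `|x| < e -> `|y| < d -> (M x y <-> g x <= y)].
Proof.
move=> tau0 cont X'0 Xinc conv [X00 Y00 Y'00] curveM tangent [d0 d00 ray] Vcont.
pose a := tau / 2.
have a0 : 0 < a by rewrite /a; lra.
have atau s : - a <= s <= a -> `|s| < tau by rewrite ltr_norml /a => ?; lra.
have aa : `|a| < tau by apply: atau; lra.
have naa : `|- a| < tau by apply: atau; lra.
have oa : `|0 : R| < tau by rewrite normr0.
have Xa0 : 0 < X a by rewrite -X00; apply: Xinc.
have Xna0 : X (- a) < 0 by rewrite -X00; apply: Xinc => //; lra.
(* [T] inverts the abscissa, so that the graph is that of [Y \o T]. *)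
pose T x := xget 0 [set s | - a <= s <= a /\ X s = x].
have TX s : - a <= s <= a -> T (X s) = s.
  move=> sa; apply: xget_unique => //= t [ta Xts].
  case: (ltgtP t s) => // ts.
    by have := Xinc _ _ (atau _ ta) (atau _ sa) ts; rewrite Xts ltxx.
  by have := Xinc _ _ (atau _ sa) (atau _ ta) ts; rewrite Xts ltxx.
have Xc : {within `[- a, a], continuous X}.
  by apply: continuous_subspace_itv => x; rewrite in_itv /= => /atau /cont[].
have Tc : {within `[X (- a), X a], continuous T}.
  apply: (@segment_can_le_continuous R _ _ X) => //; first by lra.
pose e0 := Num.min (X a) (- X (- a)).
have e00 : 0 < e0 by rewrite lt_min Xa0 oppr_gt0.
have Te x : `|x| < e0 -> [/\ - a < T x < a, X (T x) = x & {for x, continuous T}].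
  rewrite ltr_norml lt_min ltrNl lt_min => /andP[/andP[? ?] /andP[? ?]].
  have [|||s sa Xs] := @zero_between R (fun s => X s - x) (- a) a.
  - by lra.
  - move=> s /atau /cont[Xs _ _ _]; apply: (@continuousB _ _ _ X (cst x)) => //.
    exact: cst_continuous.
  - by rewrite nmulr_rlt0; lra.
  have {}Xs : x = X s by move/eqP: Xs; rewrite subr_eq0 => /eqP.
  have sa' : - a <= s <= a by move: sa => /andP[/ltW -> /ltW ->].
  rewrite Xs TX//; split=> //.
  apply: (@within_continuous_continuous _ _ _ (X (- a)) (X a) T) Tc _; first by lra.
  by rewrite in_itv /= -Xs; lra.
clearbody e0.
(* The tangent at the left end [- a] passes below the origin. *)
have [d1 d10 below] : exists2 d, 0 < d & forall x y, `|x| < d -> `|y| < d ->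
    0 < X' (- a) * (y - Y (- a)) - Y' (- a) * (x - X (- a)).
  have na0 : - a != 0 by rewrite oppr_eq0 gt_eqF.
  have := conv (- a) 0 naa oa na0; rewrite X00 Y00 !sub0r.
  set D := _ - _ => D0.
  have [d dp dD] := linear_positive_near_origin (X' (- a)) (Y' (- a)) D0.
  exists d => // x y xd yd; have := dD x y xd yd; rewrite /D; congr (0 < _); ring.
have [d2 d20 above] : exists2 d, 0 < d & forall x y, `|x| < d -> `|y| < d ->
    0 < V1 x y /\ 0 < V1 x y * (Y a - y) - V2 x y * (X a - x).
  have := conv 0 a oa aa; rewrite X00 Y00 Y'00 mul0r !subr0 => /(_ _)D0.
  have Ya : 0 < Y a.
    by rewrite -(pmulr_rgt0 _ (X'0 _ oa)); apply: D0; rewrite eq_sym gt_eqF.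
  have [e [d [e_gt0 d_gt0 dP]]] := secant_positive_near_horizontal Xa0 Ya.
  have [d' d'_gt0 dV] := Vcont _ e_gt0.
  exists (Num.min d d'); first by rewrite lt_min d_gt0.
  move=> x y; rewrite !lt_min => /andP[xd xd'] /andP[yd yd'].
  by have [V1d V2d] := dV _ _ xd' yd'; exact: dP.
clearbody a; pose dd := Num.min d0 (Num.min d1 (Num.min d2 e0)).
exists dd, dd, (Y \o T).
have dd0 : 0 < dd by rewrite /dd !lt_min d00 d10 d20 e00.
have ddP x : `|x| < dd -> [/\ `|x| < d0, `|x| < d1, `|x| < d2 & `|x| < e0].
  by rewrite /dd !lt_min => /and4P.
split=> //.
- move=> x /ddP[_ _ _ /Te[Tx _ Txc]]; apply: continuous_comp => //.
  by have [] := cont (T x) (atau _ _) => //; move: Tx => /andP[/ltW -> /ltW ->].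
- move=> x /ddP[_ _ _ /Te[Tx XTx Txc]]; exists (T x); split=> //.
  by apply: atau; move: Tx => /andP[/ltW -> /ltW ->].
move=> x y /ddP[xd0 xd1 xd2 /Te[/andP[aT Ta] XTx _]] /ddP[yd0 yd1 yd2 _] /=.
split.
  move=> Mxy; rewrite leNgt; apply/negP => yY.
  have [|||s /andP[as_ sT] Fs] := @zero_between R
    (fun s => X' s * (y - Y s) - Y' s * (x - X s)) (- a) (T x).
  - exact: ltW.
  - move=> s /andP[as_ sT]; have [|Xs Ys X's Y's] := cont s.
      by apply: atau; rewrite as_ (le_trans sT)// ltW.
    apply: (@continuousB _ _ _ (fun s => X' s * (y - Y s)) (fun s => Y' s * (x - X s))).
      apply: (@continuousM _ _ X' (fun s => y - Y s)) => //.
      by apply: (@continuousB _ _ _ (cst y) Y) => //; exact: cst_continuous.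
    apply: (@continuousM _ _ Y' (fun s => x - X s)) => //.
    by apply: (@continuousB _ _ _ (cst x) X) => //; exact: cst_continuous.
  - rewrite pmulr_rlt0 ?below// XTx subrr mulr0 subr0 nmulr_llt0 ?subr_lt0//.
    by apply: X'0; apply: atau; rewrite !ltW.
  have stau : `|s| < tau by apply: atau; rewrite !ltW// (lt_trans sT).
  have Xsx : X s < x.
    by rewrite -XTx; apply: Xinc => //; apply: atau; rewrite !ltW.
  have X's := X'0 _ stau.
  apply: (tangent s ((x - X s) / X' s) stau); first by rewrite divr_gt0// subr_gt0.
  rewrite divfK ?gt_eqF// addrC subrK.
  by rewrite (point_on_line (lt0r_neq0 X's) Fs).
move=> Yxy; apply: contrapT => nM.
have yY : Y (T x) < y.
  rewrite lt_neqAle Yxy andbT; apply/eqP => yE; apply: nM; rewrite -yE -{1}XTx.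
  by apply: curveM; apply: atau; rewrite !ltW.
have [V10 Va] := above _ _ xd2 yd2.
have [|||t /andP[Tt ta] Ft] := @zero_between R
  (fun t => V1 x y * (Y t - y) - V2 x y * (X t - x)) (T x) a.
- exact: ltW.
- move=> t /andP[Tt ta]; have [|Xs Ys _ _] := cont t.
    by apply: atau; rewrite ta (le_trans _ Tt)// ltW.
  apply: (@continuousB _ _ _ (fun t => V1 x y * (Y t - y)) (fun t => V2 x y * (X t - x))).
    apply: (@continuousM _ _ (cst (V1 x y)) (fun t => Y t - y)); first exact: cst_continuous.
    by apply: (@continuousB _ _ _ Y (cst y)) => //; exact: cst_continuous.
  apply: (@continuousM _ _ (cst (V2 x y)) (fun t => X t - x)); first exact: cst_continuous.
  by apply: (@continuousB _ _ _ X (cst x)) => //; exact: cst_continuous.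
- by rewrite pmulr_llt0// XTx subrr mulr0 subr0 pmulr_rlt0// subr_lt0.
have ttau : `|t| < tau by apply: atau; rewrite !ltW// (lt_trans aT).
have Xtx : x < X t.
  by rewrite -XTx; apply: Xinc => //; apply: atau; rewrite !ltW.
apply: (ray _ _ xd0 yd0 nM ((X t - x) / V1 x y)).
  by rewrite divr_ge0// ltW// subr_gt0.
rewrite divfK ?gt_eqF// addrC subrK.
rewrite (point_on_line (lt0r_neq0 V10) Ft); exact: curveM.
Qed.

(** * Complex limits, complex derivatives and velocities of curves *)

Lemma ReD {R : realType} (z w : R[i]) : complex.Re (z + w) = complex.Re z + complex.Re w.
Proof. by case: z w => [a b] [c d]. Qed.
Lemma ImD {R : realType} (z w : R[i]) : complex.Im (z + w) = complex.Im z + complex.Im w.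
Proof. by case: z w => [a b] [c d]. Qed.
Lemma ReN {R : realType} (z : R[i]) : complex.Re (- z) = - complex.Re z.
Proof. by case: z. Qed.
Lemma ImN {R : realType} (z : R[i]) : complex.Im (- z) = - complex.Im z.
Proof. by case: z. Qed.
Lemma ReM {R : realType} (z w : R[i]) : complex.Re (z * w) =
  complex.Re z * complex.Re w - complex.Im z * complex.Im w.
Proof. by case: z w => [a b] [c d]. Qed.
Lemma ImM {R : realType} (z w : R[i]) : complex.Im (z * w) =
  complex.Re z * complex.Im w + complex.Im z * complex.Re w.
Proof. by case: z w => [a b] [c d]. Qed.
Lemma ReC {R : realType} (x : R) : complex.Re x%:C = x. Proof. by []. Qed.
Lemma ImC {R : realType} (x : R) : complex.Im x%:C = 0. Proof. by []. Qed.

Lemma normc_complex {R : realType} (z : R[i]) : `|z| = (normc z)%:C.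
Proof. by case: z. Qed.

Lemma le_Re_normc {R : realType} (z : R[i]) : `|complex.Re z| <= normc z.
Proof.
case: z => a b /=; rewrite -sqrtr_sqr ler_wsqrtr// lerDl sqr_ge0 //.
Qed.
Lemma le_Im_normc {R : realType} (z : R[i]) : `|complex.Im z| <= normc z.
Proof.
case: z => a b /=; rewrite -sqrtr_sqr ler_wsqrtr// lerDr sqr_ge0 //.
Qed.
Lemma normc_ge0 {R : realType} (z : R[i]) : 0 <= normc z.
Proof. by case: z => a b; exact: sqrtr_ge0. Qed.
Lemma normc_le_ReIm {R : realType} (z : R[i]) :
  normc z <= `|complex.Re z| + `|complex.Im z|.
Proof.
case: z => a b /=; have h : 0 <= `|a| + `|b| by rewrite addr_ge0.
rewrite -(ger0_norm h) -sqrtr_sqr ler_wsqrtr// sqrrD !real_normK ?num_real//.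
by rewrite -addrA [X in _ <= _ + X]addrC addrA lerDl mulrn_wge0// mulr_ge0.
Qed.

(** The balls of [R[i]] have radii in [R[i]]; real radii are enough. *)
Lemma nbhs_normcP {R : realType} (z : R[i]) (U : set R[i]) :
  nbhs z U <-> exists2 e : R, 0 < e & forall w, normc (w - z) < e -> U w.
Proof.
split=> [/nbhs_ballP[e e0 eU]|[e e0 eU]].
  move: (e0); rewrite /= ltcE => /andP[/eqP Ie Re0]; exists (complex.Re e) => //.
  move=> w we; apply: eU; rewrite /ball /= -normrN opprB normc_complex ltcE /=.
  by rewrite we andbT; apply/eqP.
apply/nbhs_ballP; exists e%:C; first by rewrite /= ltcR.
by move=> w; rewrite /ball /= -normrN opprB normc_complex ltcR; exact: eU.
Qed.

Lemma normc_gt0 {R : realType} (z : R[i]) : (0 < normc z) = (z != 0).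
Proof.
rewrite lt0r normc_ge0 andbT; congr (~~ _); apply/eqP/eqP => [|->].
  exact: eq0_normc.
exact: normc0.
Qed.

Lemma near_neq0 {R : realType} (z : R[i]) : z != 0 -> \forall w \near z, w != 0.
Proof.
move=> z0; apply/nbhs_normcP; exists (normc z); first by rewrite normc_gt0.
move=> w; rewrite -[w - _]opprB; apply: contraTneq => ->.
by rewrite subr0 -leNgt; case: z {z0} => a b /=; rewrite !sqrrN.
Qed.

Lemma cvg_ReIm {R : realType} {T : Type} (F : set_system T) {FF : Filter F}
    (f : T -> R[i]) (z : R[i]) :
  f @ F --> z <-> (fun t => complex.Re (f t)) @ F --> complex.Re z /\
                  (fun t => complex.Im (f t)) @ F --> complex.Im z.
Proof.
split=> [fz|[/cvgrPdist_lt Rf /cvgrPdist_lt If]].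
  split; apply/cvgrPdist_lt => e e0.
    have : \forall w \near z, normc (w - z) < e by apply/nbhs_normcP; exists e.
    move=> H; have : F [set t | normc (f t - z) < e] := fz _ H.
    apply: filterS => t; apply: le_lt_trans.
    by rewrite -ReN -ReD -normrN -ReN opprB; exact: le_Re_normc.
  have : \forall w \near z, normc (w - z) < e by apply/nbhs_normcP; exists e.
  move=> H; have : F [set t | normc (f t - z) < e] := fz _ H.
  apply: filterS => t; apply: le_lt_trans.
  by rewrite -ImN -ImD -normrN -ImN opprB; exact: le_Im_normc.
move=> U /nbhs_normcP[e e0 eU].
have e20 : 0 < e / 2 by lra.
have : F (f @^-1` U); last by [].
apply: filterS (filterI (Rf _ e20) (If _ e20)) => t [Rt It]; apply: eU.
rewrite (le_lt_trans (normc_le_ReIm _))// [ltRHS]splitr ltrD//.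
  by rewrite ReD ReN distrC.
by rewrite ImD ImN distrC.
Qed.

Section ComplexLimits.
Context {R : realType} {T : Type} (F : set_system T).
Implicit Types (f g : T -> R[i]) (a b : R[i]).

Lemma cvgC_cst {FF : Filter F} (a : R[i]) : (fun=> a) @ F --> a.
Proof. exact: (cvg_cst a). Qed.

Lemma cvgCD {FF : Filter F} f g a b :
  f @ F --> a -> g @ F --> b -> (fun t => f t + g t) @ F --> a + b.
Proof.
move=> /cvg_ReIm[Rf If] /cvg_ReIm[Rg Ig]; apply/cvg_ReIm; rewrite ReD ImD; split.
  by under eq_fun do rewrite ReD; exact: cvgD.
by under eq_fun do rewrite ImD; exact: cvgD.
Qed.

Lemma cvgCN {FF : Filter F} f a : f @ F --> a -> (fun t => - f t) @ F --> - a.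
Proof.
move=> /cvg_ReIm[Rf If]; apply/cvg_ReIm; rewrite ReN ImN; split.
  by under eq_fun do rewrite ReN; exact: cvgN.
by under eq_fun do rewrite ImN; exact: cvgN.
Qed.

Lemma cvgCM {FF : Filter F} f g a b :
  f @ F --> a -> g @ F --> b -> (fun t => f t * g t) @ F --> a * b.
Proof.
move=> /cvg_ReIm[Rf If] /cvg_ReIm[Rg Ig]; apply/cvg_ReIm; rewrite ReM ImM; split.
  by under eq_fun do rewrite ReM; apply: cvgB; exact: cvgM.
by under eq_fun do rewrite ImM; apply: cvgD; exact: cvgM.
Qed.

Lemma normc2_gt0 a : a != 0 -> 0 < complex.Re a ^+ 2 + complex.Im a ^+ 2.
Proof.
case: a => x y; rewrite eq_complex /= => xy.
by rewrite lt0r paddr_eq0 ?sqr_ge0// !sqrf_eq0 xy addr_ge0 ?sqr_ge0.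
Qed.

Lemma ReV a : complex.Re a^-1 = complex.Re a / (complex.Re a ^+ 2 + complex.Im a ^+ 2).
Proof. by case: a. Qed.
Lemma ImV a : complex.Im a^-1 = - complex.Im a / (complex.Re a ^+ 2 + complex.Im a ^+ 2).
Proof. by case: a => x y; rewrite mulNr. Qed.

Lemma cvgCV {FF : Filter F} f a : a != 0 -> f @ F --> a -> (fun t => (f t)^-1) @ F --> a^-1.
Proof.
move=> a0 /cvg_ReIm[Rf If]; apply/cvg_ReIm; rewrite ReV ImV.
have N : (fun t => (complex.Re (f t) ^+ 2 + complex.Im (f t) ^+ 2)^-1) @ F -->
    (complex.Re a ^+ 2 + complex.Im a ^+ 2)^-1.
  apply: cvgV; first by rewrite gt_eqF// normc2_gt0.
  by apply: cvgD; rewrite expr2; under eq_fun do rewrite expr2; exact: cvgM.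
split; [under eq_fun do rewrite ReV | under eq_fun do rewrite ImV]; apply: cvgM => //.
exact: cvgN.
Qed.

End ComplexLimits.
Arguments cvgC_cst {R T F FF} a.
Arguments cvgCD {R T F FF f g a b}.
Arguments cvgCN {R T F FF f a}.
Arguments cvgCM {R T F FF f g a b}.
Arguments cvgCV {R T F FF f a}.

Lemma cvgC_id {R : realType} (z : R[i]) : (fun w : R[i] => w) @ z --> z.
Proof. exact: cvg_id. Qed.
Arguments cvgC_id {R} z.

Lemma continuous_hornerC {R : realType} (p : {poly R[i]}) (z : R[i]) :
  horner p @ z --> p.[z].
Proof.
elim/poly_ind: p => [|p c IH].
  have -> : horner (0 : {poly R[i]}) = cst 0 by apply/funext => w; rewrite horner0.
  exact: cst_continuous.
have -> : horner (p * 'X + c%:P) = (fun w => p.[w] * w + c).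
  by apply/funext => w; rewrite hornerMXaddC.
exact (cvgCD (cvgCM IH cvg_id) (cvgC_cst c)).
Qed.

Arguments continuous_hornerC {R} p z.

Lemma near_translate {R : realType} (z : R[i]) (U : set R[i]) :
  nbhs z U -> \forall h \near 0^', U (h + z).
Proof.
move=> /nbhs_normcP[e e0 eU]; apply: nbhs_dnbhs; apply/nbhs_normcP; exists e => //.
by move=> h; rewrite subr0 => he; apply: eU; rewrite addrK.
Qed.

(** Caratheodory's form of differentiability: a secant slope that is continuous
    at the point replaces the limit of difference quotients, and no division
    by an increment is left in the applications. *)
Lemma derive1_caratheodory {R : realType} (f g : R[i] -> R[i]) (z : R[i]) :
  (\forall w \near z, f w = f z + (w - z) * g w) -> g @ z --> g z ->
  derive1 f z = g z.
Proof.
move=> fg gz; rewrite /derive1; apply/cvg_lim; first exact: norm_hausdorff.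
have : (fun h => g (h + z)) @ 0^' --> g z.
  by move=> U /gz gU; exact: (near_translate gU).
apply: cvg_trans; apply: near_eq_cvg.
have := near_translate fg; apply: filterS2 (nbhs_dnbhs_neq 0) => h h0 fgh.
by rewrite /= fgh !addrK [_ + _ - f z]addrC addKr /GRing.scale /= mulKf.
Qed.

(** The polynomial [d(z) n - n(z) d] vanishes at [z]; its quotient by [w - z]
    is, up to the factor [d(w) d(z)], the secant slope of [n / d], and its
    value at [z] is obtained by differentiating the factorization. *)
Lemma derive1_rational {R : realType} (n d : {poly R[i]}) (z : R[i]) :
  d.[z] != 0 -> derive1 (fun w => n.[w] / d.[w]) z =
    (n^`().[z] * d.[z] - n.[z] * d^`().[z]) / d.[z] ^+ 2.
Proof.
move=> dz; pose m := d.[z] *: n - n.[z] *: d.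
have mz : root m z by rewrite /root /m !hornerE mulrC subrr.
have /factor_theorem[q mq] := mz.
have qz : q.[z] = n^`().[z] * d.[z] - n.[z] * d^`().[z].
  have : m^`().[z] = q.[z].
    by rewrite mq derivM derivXsubC !hornerE subrr mulr0 add0r.
  by move=> <-; rewrite /m derivB !derivZ !hornerE; congr (_ - _); rewrite mulrC.
rewrite (@derive1_caratheodory _ _ (fun w => q.[w] / (d.[w] * d.[z]))).
- by rewrite qz expr2.
- have : \forall w \near z, d.[w] != 0.
    exact: (continuous_hornerC d z _ (near_neq0 dz)).
  apply: filterS => w dw.
  have : n.[w] * d.[z] - n.[z] * d.[w] = (w - z) * q.[w].
    have : m.[w] = q.[w] * (w - z) by rewrite mq !hornerE.
    by rewrite /m !hornerE mulrC => ->; rewrite mulrC.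
  move=> nd; rewrite mulrA -nd; field; by rewrite dw dz.
- refine (cvgCM (continuous_hornerC _ z) (cvgCV _ _)).
    by rewrite mulf_neq0.
  exact (cvgCM (continuous_hornerC _ z) (cvgC_cst _)).
Qed.

Section Velocity.
Context {R : realType}.
Implicit Types (b c : R -> R[i]) (t : R) (u v : R[i]) (p : {poly R[i]}).

Lemma velocity_eq c t u v : u = v -> has_velocity c t u -> has_velocity c t v.
Proof. by move=> ->. Qed.

Lemma velocity_cst u t : has_velocity (fun=> u) t 0.
Proof. by split; exact: is_derive_cst. Qed.

Lemma velocityD b c t u v : has_velocity b t u -> has_velocity c t v ->
  has_velocity (fun s => b s + c s) t (u + v).
Proof.
move=> [Rb Ib] [Rc Ic]; split.
  by under eq_fun do rewrite ReD; rewrite ReD; exact: is_deriveD.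
by under eq_fun do rewrite ImD; rewrite ImD; exact: is_deriveD.
Qed.

Lemma velocityM b c t u v : has_velocity b t u -> has_velocity c t v ->
  has_velocity (fun s => b s * c s) t (u * c t + b t * v).
Proof.
move=> [Rb Ib] [Rc Ic]; split.
  under eq_fun do rewrite ReM; rewrite ReD !ReM.
  refine (is_derive_eq (is_deriveB (is_deriveM Rb Rc) (is_deriveM Ib Ic)) _).
  by rewrite /GRing.scale /=; ring.
under eq_fun do rewrite ImM; rewrite ImD !ImM.
refine (is_derive_eq (is_deriveD (is_deriveM Rb Ic) (is_deriveM Ib Rc)) _).
by rewrite /GRing.scale /=; ring.
Qed.

Lemma velocity_horner p c t v : has_velocity c t v ->
  has_velocity (fun s => p.[c s]) t (p^`().[c t] * v).
Proof.
move=> cv; elim/poly_ind: p => [|p a IH].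
  under eq_fun do rewrite horner0; rewrite deriv0 horner0 mul0r; exact: velocity_cst.
under eq_fun do rewrite hornerMXaddC.
apply: velocity_eq (velocityD (velocityM IH cv) (velocity_cst a t)).
by rewrite derivD derivM derivX derivC !hornerE; ring.
Qed.

Lemma velocityV c t v : c t != 0 -> has_velocity c t v ->
  has_velocity (fun s => (c s)^-1) t (- v / c t ^+ 2).
Proof.
move=> c0 [Rc Ic]; have := normc2_gt0 c0; rewrite lt0r => /andP[N0 _].
have dN : is_derive t 1 (fun s => (complex.Re (c s) ^+ 2 + complex.Im (c s) ^+ 2)^-1)
    (- (complex.Re (c t) ^+ 2 + complex.Im (c t) ^+ 2) ^- 2 *
      (complex.Re (c t) * complex.Re v + complex.Im (c t) * complex.Im v) *+ 2).
  have dn : is_derive t 1 (fun s => complex.Re (c s) ^+ 2 + complex.Im (c s) ^+ 2)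
     ((complex.Re (c t) * complex.Re v + complex.Im (c t) * complex.Im v) *+ 2).
    refine (is_derive_eq (is_deriveD (is_deriveX 2 Rc) (is_deriveX 2 Ic)) _).
    by rewrite /GRing.scale /= !expr1; ring.
  apply: DeriveDef; first by apply: derivableV.
  by rewrite deriveV// derive_val /GRing.scale /=; ring.
have vE : - v / c t ^+ 2 = - v * (c t)^-1 ^+ 2 by rewrite exprVn.
split.
  under eq_fun do rewrite ReV.
  refine (is_derive_eq (is_deriveM Rc dN) _).
  by rewrite vE expr2 !(ImM,ReM) ReV ImV ReN ImN /GRing.scale /=; field.
under eq_fun do rewrite ImV.
refine (is_derive_eq (is_deriveM (is_deriveN Ic) dN) _).
by rewrite fctE vE expr2 !(ImM,ReM) ReV ImV ReN ImN /GRing.scale /=; field.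
Qed.

Lemma velocity_rational (n d : {poly R[i]}) c t v : d.[c t] != 0 ->
  has_velocity c t v ->
  has_velocity (fun s => n.[c s] / d.[c s]) t
    ((n^`().[c t] * d.[c t] - n.[c t] * d^`().[c t]) / d.[c t] ^+ 2 * v).
Proof.
move=> d0 cv.
apply: velocity_eq (velocityM (velocity_horner n cv) (velocityV d0 (velocity_horner d cv))).
by field.
Qed.

End Velocity.

(** * The complex exponential and the derivative of a branch of a power *)

Lemma cexpD {R : realType} (z w : R[i]) : cexp (z + w) = cexp z * cexp w.
Proof.
case: z w => [a b] [c d]; rewrite /cexp /= expRD cosD sinD.
by apply/eqP; rewrite eq_complex /=; apply/andP; split; apply/eqP; ring.
Qed.

Lemma cexp0 {R : realType} : cexp (0 : R[i]) = 1.
Proof.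
rewrite /cexp /= expR0 cos0 sin0.
by apply/eqP; rewrite eq_complex /=; apply/andP; split; apply/eqP; ring.
Qed.

Lemma cexp_neq0 {R : realType} (z : R[i]) : cexp z != 0.
Proof.
have := @cexpD R z (- z); rewrite subrr cexp0 => /eqP; apply: contraTneq => ->.
by rewrite mul0r oner_eq0.
Qed.

Lemma real_caratheodory {R : realType} (f : R -> R) (d : R) :
  is_derive (0 : R) (1 : R) f d ->
  exists2 q : R -> R, q @ (0 : R) --> d & forall x, f x = f 0 + x * q x.
Proof.
move=> [df fd]; pose q x := if x == 0 then d else (f x - f 0) / x.
exists q; last first.
  move=> x; rewrite /q; case: eqVneq => [->|x0]; first by rewrite mul0r addr0.
  by rewrite mulrCA mulfV// mulr1 addrC subrK.
have q0 : q 0 = d by rewrite /q eqxx.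
have : (fun h : R => h^-1 *: (f (h *: 1 + 0) - f 0)) @ 0^' --> d by rewrite -fd; exact: df.
move=> qd; have : q @ 0^' --> q 0.
  rewrite q0; apply: cvg_trans qd; apply: near_eq_cvg.
  apply: filterS (nbhs_dnbhs_neq 0) => h h0.
  by rewrite /q (negPf h0) addr0 /GRing.scale /= mulr1 mulrC.
by move=> /continuous_withinNx qc; rewrite -[X in _ --> X]q0.
Qed.

Lemma cvg_bounded_combination {R : realType} {T : Type} {F : set_system T}
    {FF : Filter F} (x y u v : T -> R[i]) :
  (\forall t \near F, normc (x t) <= 1) -> (\forall t \near F, normc (y t) <= 1) ->
  u @ F --> (0 : R[i]) -> v @ F --> (0 : R[i]) ->
  (fun t => x t * u t + y t * v t) @ F --> (0 : R[i]).
Proof.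
move=> x1 y1 u0 v0 U /nbhs_normcP[e e0 eU].
have e20 : 0 < e / 2 by lra.
have small w : w @ F --> (0 : R[i]) -> F [set t | normc (w t) < e / 2].
  move=> w0; apply: (w0 [set z | normc z < e / 2]); apply/nbhs_normcP.
  by exists (e / 2) => // z; rewrite subr0.
have : F ((fun t => x t * u t + y t * v t) @^-1` U); last by [].
apply: filterS2 (filterI x1 y1) (filterI (small _ u0) (small _ v0)).
move=> t [xt yt] [ut vt]; apply: eU; rewrite subr0.
rewrite (le_lt_trans (complex.le_normcD _ _))// [ltRHS]splitr.
rewrite !normcM ltrD//.
  by apply: le_lt_trans ut; rewrite ler_piMl// normc_ge0.
by apply: le_lt_trans vt; rewrite ler_piMl// normc_ge0.
Qed.

Lemma difference_quotient_split {K : fieldType} (h j x y a b : K) :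
  h != 0 -> h = x + j * y ->
  ((1 + x * a) * (1 + y * b) - 1) / h =
  1 + (x / h * (a - 1) + y / h * ((1 + x * a) * b - j)).
Proof.
move=> h0 hE; have -> : x = h - j * y by rewrite hE addrK.
by field.
Qed.

(** The real functions [exp], [cos] and [sin] have continuous secant slopes [a],
    [b] and [s] at 0, so that [exp (x + i y)] is the product of [1 + x a] and
    [1 + y (b + i s)]. Since [|x|] and [|y|] are at most [|h|], the slopes add
    up to one that tends to 1. *)
Lemma cexp_caratheodory {R : realType} :
  exists E : R[i] -> R[i], [/\ E @ (0 : R[i]) --> (1 : R[i]), E 0 = 1 &
    forall h, cexp h = 1 + h * E h].
Proof.
pose E (h : R[i]) := if h == 0 then 1 else (cexp h - 1) / h.
exists E; split; [| by rewrite /E eqxx |]; last first.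
  move=> h; rewrite /E; case: eqVneq => [->|h0]; first by rewrite mul0r addr0 cexp0.
  by rewrite mulrCA mulfV// mulr1 addrC subrK.
have [a a1 expE] := real_caratheodory (is_derive_expR (0 : R)).
have [b b0 cosE] := real_caratheodory (is_derive_cos (0 : R)).
have [s s1 sinE] := real_caratheodory (is_derive_sin (0 : R)).
move: a1 b0 s1 expE cosE sinE; rewrite expR0 cos0 sin0 oppr0.
move=> a1 b0 s1 expE cosE sinE.
have [Re0 Im0] : (fun h : R[i] => complex.Re h) @ (0 : R[i]) --> (0 : R) /\
    (fun h : R[i] => complex.Im h) @ (0 : R[i]) --> (0 : R).
  by have /cvg_ReIm : (fun h : R[i] => h) @ (0 : R[i]) --> (0 : R[i]) by exact: cvg_id.
pose x (h : R[i]) := (complex.Re h)%:C; pose y (h : R[i]) := (complex.Im h)%:C.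
pose A (h : R[i]) := (a (complex.Re h))%:C.
pose B (h : R[i]) := b (complex.Im h) +i* s (complex.Im h).
pose U h := A h - 1; pose W h := (1 + x h * A h) * B h - 'i.
have ca : (fun h : R[i] => a (complex.Re h)) @ (0 : R[i]) --> (1 : R).
  exact (cvg_comp _ _ Re0 a1).
have cb : (fun h : R[i] => b (complex.Im h)) @ (0 : R[i]) --> (0 : R).
  exact (cvg_comp _ _ Im0 b0).
have cs : (fun h : R[i] => s (complex.Im h)) @ (0 : R[i]) --> (1 : R).
  exact (cvg_comp _ _ Im0 s1).
have c0 : (fun=> 0) @ (0 : R[i]) --> (0 : R).
  exact: (@cst_continuous _ _ (0 : R) (0 : R[i])).
have cA : A @ (0 : R[i]) --> (1 : R[i]).
  exact (proj2 (@cvg_ReIm R _ _ (nbhs_filter _) A 1) (conj ca c0)).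
have cB : B @ (0 : R[i]) --> ('i : R[i]).
  exact (proj2 (@cvg_ReIm R _ _ (nbhs_filter _) B 'i) (conj cb cs)).
have cx : x @ (0 : R[i]) --> (0 : R[i]).
  exact (proj2 (@cvg_ReIm R _ _ (nbhs_filter _) x 0) (conj Re0 c0)).
have cU : U @ (0 : R[i]) --> (1 - 1 : R[i]) by exact: (cvgCD cA (cvgC_cst (- 1))).
have cW : W @ (0 : R[i]) --> ((1 + 0 * 1) * 'i - 'i : R[i]).
  exact: (cvgCD (cvgCM (cvgCD (cvgC_cst 1) (cvgCM cx cA)) cB) (cvgC_cst (- 'i))).
rewrite subrr in cU; rewrite mul0r addr0 mul1r subrr in cW.
have EE : E = (fun h => 1 + (x h / h * U h + y h / h * W h)).
  apply/funext => h; rewrite /E; case: eqVneq => [->|h0].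
    by rewrite invr0 !mulr0 !mul0r !addr0.
  have hE : h = x h + 'i * y h by case: (h) => p q; rewrite /x /y; simpc.
  have -> : cexp h = (1 + x h * A h) * (1 + y h * B h).
    rewrite /cexp expE cosE sinE /x /A /y /B; case: (h) => p q /=.
    by apply/eqP; rewrite eq_complex /=; apply/andP; split; apply/eqP; ring.
  exact: difference_quotient_split.
have bd (p : R[i] -> R) : (forall h, `|p h| <= normc h) ->
    \forall h \near (0 : R[i]), normc ((p h)%:C / h) <= 1.
  move=> ph; near=> h; have [->|h0] := eqVneq h 0.
    by rewrite invr0 mulr0 normc0.
  rewrite normcM normcV.
  rewrite ler_pdivrMr ?mul1r; first by rewrite /= expr0n /= addr0 sqrtr_sqr.
  by rewrite normc_gt0.
have cUW : (fun h => x h / h * U h + y h / h * W h) @ (0 : R[i]) --> (0 : R[i]).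
  by exact: (cvg_bounded_combination (bd _ le_Re_normc) (bd _ le_Im_normc) cU cW).
have : (fun h => 1 + (x h / h * U h + y h / h * W h)) @ (0 : R[i]) --> (1 + 0 : R[i]).
  by exact: (cvgCD (cvgC_cst 1) cUW).
by rewrite addr0 -EE.
Unshelve. all: by end_near. Qed.

(** Only the continuity of the determination [L] is given. But with
    [D w = L w - L z] one has [w - z = (z - u) (exp (D w) - 1)] and
    [f w = f z exp (t D w)], so the secant slopes of the exponential give one
    for [f]: the increments [D w] cancel. *)
Lemma branch_derivative {R : realType} (u : R[i]) (t : R) (z : R[i]) (f : R[i] -> R[i]) :
  z != u -> power_branch u t z f ->
  f z != 0 /\ derive1 f z = t%:C * f z / (z - u).
Proof.
move=> zu [L Lf]; have [Lz Lez fz] := nbhs_singleton Lf.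
have zu0 : z - u != 0 by rewrite subr_eq0.
split; first by rewrite fz cexp_neq0.
have [E [E1 E01 cE]] := @cexp_caratheodory R.
pose D w := L w - L z.
have D0 : D @ z --> (0 : R[i]).
  have Dz : D @ z --> (L z - L z : R[i]) by exact: (cvgCD Lz (cvgC_cst (- L z))).
  by rewrite subrr in Dz.
have ED : (fun w => E (D w)) @ z --> (1 : R[i]) by exact (cvg_comp _ _ D0 E1).
have EtD : (fun w => E (t%:C * D w)) @ z --> (1 : R[i]).
  have tD0 : (fun w => t%:C * D w) @ z --> (t%:C * 0 : R[i]).
    by exact: (cvgCM (cvgC_cst _) D0).
  rewrite mulr0 in tD0; exact (cvg_comp _ _ tD0 E1).
pose g w := f z * t%:C * E (t%:C * D w) / ((z - u) * E (D w)).
have gz : g z = t%:C * f z / (z - u).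
  by rewrite /g /D subrr mulr0 E01 !mulr1 [f z * _]mulrC.
rewrite -gz; apply: derive1_caratheodory.
  have Enz : \forall w \near z, E (D w) != 0.
    exact: (ED _ (near_neq0 (oner_neq0 _))).
  apply: filterS2 Lf Enz => w [_ Lew fw] Ew.
  have hw : w - z = (z - u) * (D w * E (D w)).
    have : w - u = (z - u) * (1 + D w * E (D w)).
      by rewrite -Lew -Lez -cE -cexpD /D addrC subrK.
    by move=> wu; have -> : w - z = (w - u) - (z - u); [ring|rewrite wu; ring].
  have fwE : f w = f z * (1 + t%:C * D w * E (t%:C * D w)).
    by rewrite fw fz -cE -cexpD; congr cexp; rewrite /D; ring.
  by rewrite fwE hw /g; field; rewrite Ew zu0.
have -> : g z = f z * t%:C * 1 * ((z - u) * 1)^-1 by rewrite gz !mulr1 [f z * _]mulrC.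
have zu1 : (z - u) * 1 != 0 by rewrite mulr1.
exact: (cvgCM (cvgCM (cvgC_cst _) EtD) (cvgCV zu1 (cvgCM (cvgC_cst _) ED))).
Qed.

(** * Complex logarithms and the roots of the image of a power *)

(** The principal logarithm on the right half-plane. The modulus is written
    [Re z / cos a], where [a] is the argument, which makes the continuity
    immediate. *)
Definition principal_log {R : realType} (z : R[i]) : R[i] :=
  let a := atan (complex.Im z / complex.Re z) in ln (complex.Re z / cos a) +i* a.

Lemma cos_atan_gt0 {R : realType} (x : R) : 0 < cos (atan x).
Proof. by apply: cos_gt0_pihalf; rewrite atan_gtNpi2 atan_ltpi2. Qed.

Lemma principal_logK {R : realType} (z : R[i]) :
  0 < complex.Re z -> cexp (principal_log z) = z.
Proof.
move=> z0; rewrite /cexp /principal_log /=; set a := atan _.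
have a0 : 0 < cos a by exact: cos_atan_gt0.
have sa : complex.Re z * (sin a / cos a) = complex.Im z.
  by rewrite -/(tan a) atanK mulrCA mulfV ?mulr1// gt_eqF.
rewrite lnK ?qualifE/= ?divr_gt0//; move: sa z0; case: z a a0 => x y a a0 /= sa z0.
apply/eqP; rewrite eq_complex /= !mul0r subr0 addr0; apply/andP; split; apply/eqP.
  by rewrite mulfVK// gt_eqF.
by rewrite -sa mulrA mulrAC.
Qed.

Lemma cvg_principal_log {R : realType} {T : Type} {F : set_system T} {FF : Filter F}
    (f : T -> R[i]) (z : R[i]) :
  0 < complex.Re z -> f @ F --> z -> (fun t => principal_log (f t)) @ F --> principal_log z.
Proof.
move=> z0 /cvg_ReIm[Rf If].
have fa : (fun t => atan (complex.Im (f t) / complex.Re (f t))) @ F -->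
    atan (complex.Im z / complex.Re z).
  have fq : (fun t => complex.Im (f t) / complex.Re (f t)) @ F -->
      complex.Im z / complex.Re z.
    by apply: cvgM => //; apply: cvgV => //; rewrite gt_eqF.
  exact (cvg_comp _ _ fq (@continuous_atan R _)).
apply/cvg_ReIm; split=> //=.
have fc : (fun t => complex.Re (f t) / cos (atan (complex.Im (f t) / complex.Re (f t)))) @ F
   --> complex.Re z / cos (atan (complex.Im z / complex.Re z)).
  apply: cvgM => //; apply: cvgV; first by rewrite gt_eqF// cos_atan_gt0.
  exact (cvg_comp _ _ fa (@continuous_cos R _)).
refine (cvg_comp _ _ fc _); apply: continuous_ln.
by rewrite divr_gt0// cos_atan_gt0.
Qed.

(** Multiplication by [i = exp (i pi / 2)] and by [-1 = exp (i pi)] brings any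
    nonzero number into the right half-plane. *)
Lemma cexp_surjective {R : realType} (z : R[i]) : z != 0 -> exists l, cexp l = z.
Proof.
have base (w : R[i]) : 0 < complex.Re w -> exists l, cexp l = w.
  by move=> w0; exists (principal_log w); exact: principal_logK.
have half (w : R[i]) : 0 < complex.Re w \/ 0 < complex.Im w -> exists l, cexp l = w.
  case=> [/base //|w0]; have [|l lE] := base (- 'i * w).
    by case: w w0 => x y /=; rewrite oppr0 !mul0r mulN1r opprK add0r.
  exists (0 +i* (pi / 2) + l); rewrite cexpD lE /cexp /= expR0 cos_pihalf sin_pihalf.
  case: w {w0 lE} => x y; apply/eqP; rewrite eq_complex /=.
  by apply/andP; split; apply/eqP; ring.
have neg (w : R[i]) : 0 < complex.Re (- w) \/ 0 < complex.Im (- w) -> exists l, cexp l = w.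
  move=> /half[l lE]; exists (0 +i* pi + l).
  rewrite cexpD lE /cexp /= expR0 cospi sinpi.
  case: w {lE} => x y; apply/eqP; rewrite eq_complex /=.
  by apply/andP; split; apply/eqP; ring.
case: z => x y; rewrite eq_complex /= negb_and => xy.
case: (ltgtP x 0) xy => [x0 _|x0 _|-> /=].
- by apply: neg; left; rewrite /= oppr_gt0.
- by apply: base.
move=> /lt_total/orP[y0|y0].
  by apply: neg; right; rewrite /= oppr_gt0.
by apply: half; right.
Qed.

(** Near [z] the quotient [(w - u) / (z - u)] stays in the right half-plane,
    where the principal logarithm is continuous. *)
Lemma power_branch_exists {R : realType} (u : R[i]) (t : R) (z : R[i]) :
  z != u -> exists f, power_branch u t z f.
Proof.
rewrite -subr_eq0 => zu; have [l lE] := cexp_surjective zu.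
pose q (w : R[i]) : R[i] := (w - u) / (z - u).
pose L (w : R[i]) : R[i] := l + principal_log (q w).
exists (fun w => cexp (t%:C * L w)), L.
have cq (w : R[i]) : q @ w --> q w.
  exact (cvgCM (cvgCD (cvgC_id w) (cvgC_cst (- u))) (cvgC_cst (z - u)^-1)).
have q1 : \forall w \near z, 0 < complex.Re (q w).
  have : (fun w => complex.Re (q w)) @ z --> complex.Re (q z) by have /cvg_ReIm[] := cq z.
  by move=> /cvgr_gt; apply; rewrite /q divff//= ltr01.
apply: filterS q1 => w w0; split=> //.
  exact (cvgCD (cvgC_cst l) (cvg_principal_log w0 (cq w))).
by rewrite /L cexpD lE principal_logK// /q mulrCA mulfV// mulr1.
Qed.

(** By [branch_derivative], the image of a branch [f] of [(w - u)^t] is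
    [f(z) / (z - u)] times the left-hand side of the equation, and [f] does not
    vanish. *)
Lemma image_rootP {R : realType} (P Q : {poly R[i]}) (u : R[i]) (t : R) (z : R[i]) :
  z != u -> image_root P Q u t z <-> t%:C * Q.[z] + P.[z] * (z - u) = 0.
Proof.
move=> zu; have zu0 : z - u != 0 by rewrite subr_eq0.
have TE f : power_branch u t z f ->
    Top P Q f z = f z / (z - u) * (t%:C * Q.[z] + P.[z] * (z - u)) /\ f z != 0.
  by move=> /(branch_derivative zu)[fz0 df]; split=> //; rewrite /Top df; field.
split=> [[_ [f /TE[-> fz0]]]|e0].
  by move=> /eqP; rewrite mulf_eq0 (negPf (mulf_neq0 fz0 (invr_neq0 zu0))) => /eqP.
split=> //; have [f fb] := power_branch_exists t zu; exists f => //.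
by rewrite (TE f fb).1 e0 mulr0.
Qed.

(** * The rays of points outside an invariant set *)

Lemma poly_zero_off_point {R : realType} (m : {poly R[i]}) (u : R[i]) :
  (forall z, z != u -> m.[z] = 0) -> m = 0.
Proof.
move=> m0; have [//|mN0] := eqVneq (m * ('X - u%:P)) 0.
  by move/eqP; rewrite mulf_eq0 polyXsubC_eq0 orbF => /eqP.
pose s := [seq (k%:R : R[i]) | k <- iota 0 (size (m * ('X - u%:P)))].
have := @max_poly_roots _ _ s mN0; rewrite size_map size_iota ltnn => h.
exfalso; suff : false by []; apply: h.
  apply/allP => _ /mapP[k _ ->]; rewrite /root !hornerE.
  by have [->|/m0 ->] := eqVneq (k%:R : R[i]) u; rewrite ?subrr ?mulr0 ?mul0r.
by rewrite map_inj_uniq ?iota_uniq//; exact: mulrIn (oner_neq0 _).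
Qed.

Section Reduced.
Context {R : realType}.
Variables (P Q : {poly R[i]}).
Hypothesis P0 : P != 0.

Let g := gcdp P Q.
Let n := Q %/ g.
Let d := P %/ g.

Let Pdg : P = d * g. Proof. by rewrite divpK// dvdp_gcdl. Qed.
Let Qng : Q = n * g. Proof. by rewrite divpK// dvdp_gcdr. Qed.
Let g0 : g != 0. Proof. by rewrite gcdp_eq0 negb_and P0. Qed.

Lemma ratfunE z : P.[z] != 0 -> ratfun P Q z = Q.[z] / P.[z].
Proof.
have PE : P.[z] = d.[z] * g.[z] by rewrite {1}Pdg hornerM.
have QE : Q.[z] = n.[z] * g.[z] by rewrite {1}Qng hornerM.
rewrite PE QE mulf_eq0 negb_or => /andP[d0 gz0].
by rewrite /ratfun -/g -/n -/d; field; rewrite gz0.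
Qed.

Lemma not_pole z : P.[z] != 0 -> ~~ pole P Q z.
Proof. by rewrite {1}Pdg hornerM mulf_eq0 negb_or => /andP[]. Qed.

Definition dratfun z : R[i] :=
  (n^`().[z] * d.[z] - n.[z] * d^`().[z]) / d.[z] ^+ 2.

Lemma derive1_ratfun z : ~~ pole P Q z -> derive1 (ratfun P Q) z = dratfun z.
Proof. exact: derive1_rational. Qed.

(** If all the rays go through one point [u], then [Q / P] is [(u - z) / t] and
    its derivative is the real constant [- 1 / t]. *)
Lemma pencil_slope (u : R[i]) (t : R) :
  t%:C *: Q + P * ('X - u%:P) = 0 ->
  forall z, ~~ pole P Q z -> complex.Im (dratfun z) = 0.
Proof.
move=> pz z dz.
have {}pz : t%:C *: n + d * ('X - u%:P) = 0.
  apply: (mulIf g0); rewrite mul0r -[RHS]pz {1}Pdg {1}Qng.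
  by rewrite mulrDl -!scalerAl; congr (_ + _); rewrite mulrAC.
have e1 : t%:C * n.[z] = - (d.[z] * (z - u)).
  have := congr1 (horner^~ z) pz; rewrite !hornerE => /eqP.
  by rewrite addr_eq0 => /eqP.
have e2 : t%:C * n^`().[z] = - (d^`().[z] * (z - u) + d.[z]).
  have := congr1 (fun p => p^`().[z]) pz.
  rewrite derivD derivZ derivM derivXsubC deriv0 mulr1 hornerD hornerZ hornerD.
  rewrite hornerM hornerXsubC horner0 => /eqP.
  by rewrite addr_eq0 => /eqP.
have tD : t%:C * dratfun z = -1.
  by rewrite /dratfun mulrA mulrBr !mulrA e1 e2; field.
have t0 : t != 0.
  by apply: contra_eq_neq tD => ->; rewrite mul0r eq_sym oppr_eq0 oner_eq0.
have := congr1 (@complex.Im R) tD.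
rewrite ImM /= mul0r addr0 oppr0 => /eqP; rewrite mulf_eq0 (negPf t0) => /eqP //.
Qed.

End Reduced.

(** A point [u] of [M] on the ray of [z] at parameter [r] makes [z] a root of
    the image of [(w - u)^r]. The point [z1] rules out the case in which this
    image vanishes identically, by [pencil_slope]. *)
Lemma ray_misses_invariant {R : realType} (P Q : {poly R[i]}) (M : set R[i]) :
  P != 0 -> TCH_invariant P Q M ->
  (exists2 z, ~~ pole P Q z & complex.Im (dratfun P Q z) != 0) ->
  forall z r, P.[z] != 0 -> ~ M z -> 0 <= r -> ~ M (z + r%:C * ratfun P Q z).
Proof.
move=> P0 [_ inv] [z1 z1p z1i] z r Pz Mz r0; set u := z + _ => Mu.
have zu : z != u by apply/eqP => zu; apply: Mz; rewrite zu.
have zroot : image_root P Q u r z.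
  by apply/image_rootP => //; rewrite /u ratfunE//; field.
have [/(_ _ zroot) //|all_roots] := inv u Mu r r0.
have : r%:C *: Q + P * ('X - u%:P) = 0.
  apply: (@poly_zero_off_point _ _ u) => w wu.
  by have /image_rootP := all_roots w wu; rewrite !hornerE; apply.
by move=> /(pencil_slope P0)/(_ _ z1p); apply/eqP.
Qed.

(** * Arcs of positive curvature *)

Lemma is_derive_continuous {R : realType} (f : R -> R) (x d : R) :
  is_derive x (1 : R) f d -> {for x, continuous f}.
Proof. by move=> [df _]; exact/differentiable_continuous/derivable1_diffP. Qed.

Lemma mean_value {R : realType} (f f' : R -> R) (a b : R) :
  a < b -> (forall x, a <= x <= b -> is_derive x (1 : R) f (f' x)) ->
  exists2 x, a < x < b & f b - f a = f' x * (b - a).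
Proof.
move=> ab df; have [||x xab fx] := @MVT R f f' a b ab.
- by move=> x; rewrite in_itv /= => /andP[? ?]; apply: df; rewrite !ltW.
- apply: continuous_subspace_itv => x; rewrite in_itv /= => /df.
  exact: is_derive_continuous.
by exists x => //; rewrite in_itv in xab.
Qed.

(** The slope [Y' / X'] has derivative [(X' Y'' - Y' X'') / X'^2], so it
    increases, and the mean value theorem compares each chord with the tangent
    at one of its ends. *)
Lemma turning_arc_convex {R : realType} (X Y X' Y' X'' Y'' : R -> R) (tau : R) :
  (forall s : R, `|s| < tau ->
     is_derive s (1 : R) X (X' s) /\ is_derive s (1 : R) Y (Y' s)) ->
  (forall s : R, `|s| < tau ->
     is_derive s (1 : R) X' (X'' s) /\ is_derive s (1 : R) Y' (Y'' s)) ->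
  (forall s : R, `|s| < tau -> 0 < X' s) ->
  (forall s : R, `|s| < tau -> 0 < X' s * Y'' s - Y' s * X'' s) ->
  (forall s t : R, `|s| < tau -> `|t| < tau -> s < t -> X s < X t) /\
  (forall s t : R, `|s| < tau -> `|t| < tau -> s != t ->
     0 < X' s * (Y t - Y s) - Y' s * (X t - X s)).
Proof.
move=> dXY dXY' X'0 turn.
have between s t x : `|s| < tau -> `|t| < tau -> s <= x <= t -> `|x| < tau.
  rewrite !ltr_norml => /andP[? ?] /andP[? ?] /andP[? ?]; apply/andP; split; lra.
pose m s := Y' s / X' s.
have minc s t : `|s| < tau -> `|t| < tau -> s < t -> m s < m t.
  move=> st tt lt_st.
  have [|x /andP[sx xt]] := @mean_value R m
    (fun x => (X' x * Y'' x - Y' x * X'' x) / X' x ^+ 2) s t lt_st.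
    move=> x /(between _ _ _ st tt) xtau; have [dX' dY'] := dXY' x xtau.
    have X'x := lt0r_neq0 (X'0 x xtau).
    have dV : is_derive x (1 : R) (fun x => (X' x)^-1) (- X'' x / X' x ^+ 2).
      apply: DeriveDef; first by apply: derivableV.
      by rewrite deriveV// derive_val /GRing.scale /= mulrC mulrN mulNr.
    by refine (is_derive_eq (is_deriveM dY' dV) _); rewrite /GRing.scale /=; field.
  have xtau : `|x| < tau by apply: (between s t) => //; rewrite !ltW.
  move=> mE; rewrite -subr_gt0 mE mulr_gt0 ?subr_gt0// divr_gt0 ?turn//.
  by rewrite exprn_gt0// X'0.
split=> [s t st tt lt_st|s t st tt].
  have [|x /andP[sx xt] XE] := @mean_value R X X' s t lt_st.
    by move=> x /(between _ _ _ st tt) /dXY[].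
  rewrite -subr_gt0 XE mulr_gt0 ?subr_gt0// X'0//.
  by apply: (between s t) => //; rewrite !ltW.
pose h t := X' s * (Y t - Y s) - Y' s * (X t - X s).
have dh x : `|x| < tau -> is_derive x (1 : R) h (X' s * Y' x - Y' s * X' x).
  move=> /dXY[dX dY].
  have dk (k : R) : is_derive x (1 : R) (cst k) 0 by exact: is_derive_cst.
  refine (is_derive_eq (is_deriveB (is_deriveM (dk (X' s)) (is_deriveB dY (dk (Y s))))
     (is_deriveM (dk (Y' s)) (is_deriveB dX (dk (X s))))) _).
  by rewrite /GRing.scale /=; ring.
have hE x : `|x| < tau -> X' s * Y' x - Y' s * X' x = X' s * X' x * (m x - m s).
  by move=> xtau; rewrite /m; field; rewrite !gt_eqF ?X'0.
have h0 : h s = 0 by rewrite /h !subrr !mulr0 subrr.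
rewrite -/(h t); case: (ltgtP s t) => // [lt_st _|lt_ts _].
  have [x /andP[sx xt]] := @mean_value R h _ s t lt_st
    (fun x sxt => dh x (between _ _ _ st tt sxt)).
  have xtau : `|x| < tau by apply: (between s t) => //; rewrite !ltW.
  rewrite h0 subr0 => ->; rewrite hE// !mulr_gt0 ?subr_gt0 ?X'0//.
  exact: minc.
have [x /andP[tx xs]] := @mean_value R h _ t s lt_ts
  (fun x sxt => dh x (between _ _ _ tt st sxt)).
have xtau : `|x| < tau by apply: (between t s) => //; rewrite !ltW.
rewrite h0 sub0r => hN; rewrite -oppr_lt0 hN hE// pmulr_llt0 ?subr_gt0//.
by rewrite pmulr_rlt0 ?mulr_gt0 ?X'0// subr_lt0; exact: minc.
Qed.

(** * An integral curve bounds the invariant set on one side *)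

(** Coordinates at [z0] in which [v] is the first basis vector. The factor
    [sg = -1] reflects the plane in the line directed by [v], so that curves
    turning to the right are seen as turning to the left. *)
Definition frame {R : realType} (z0 v : R[i]) (sg x y : R) : R[i] :=
  z0 + v * (x +i* (sg * y)).

Lemma velocity_shift {R : realType} (c : R -> R[i]) (t0 s : R) (v : R[i]) :
  has_velocity c (t0 + s) v -> has_velocity (fun s => c (t0 + s)) s v.
Proof.
have dsh : is_derive s (1 : R) (fun s => t0 + s) (1 : R).
  refine (is_derive_eq (is_deriveD (is_derive_cst t0 s 1) (is_derive_id s 1)) _).
  by rewrite add0r.
move=> [Rc Ic]; split.
  by refine (is_derive_eq (is_derive1_comp Rc dsh) _); rewrite mulr1.
by refine (is_derive_eq (is_derive1_comp Ic dsh) _); rewrite mulr1.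
Qed.

Lemma has_velocity_cvg {R : realType} (c : R -> R[i]) (t : R) (v : R[i]) :
  has_velocity c t v -> c @ t --> c t.
Proof. by move=> [Rc Ic]; apply/cvg_ReIm; split; exact: is_derive_continuous. Qed.

Lemma velocity_ratfun {R : realType} (P Q : {poly R[i]}) (c : R -> R[i]) (t : R) (v : R[i]) :
  ~~ pole P Q (c t) -> has_velocity c t v ->
  has_velocity (fun s => ratfun P Q (c s)) t (dratfun P Q (c t) * v).
Proof. exact: velocity_rational. Qed.

Section Frame.
Context {R : realType}.
Variables (z0 v : R[i]) (sg : R).
Hypotheses (v0 : v != 0) (sg2 : sg * sg = 1).

Lemma frameK z :
  frame z0 v sg (complex.Re ((z - z0) / v)) (sg * complex.Im ((z - z0) / v)) = z.
Proof.
rewrite /frame mulrA sg2 mul1r.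
have -> : complex.Re ((z - z0) / v) +i* complex.Im ((z - z0) / v) = (z - z0) / v.
  by case: (_ / v).
by rewrite mulrCA mulfV// mulr1 addrC subrK.
Qed.

Lemma frame_step x y w (r : R) :
  frame z0 v sg x y + r%:C * w =
  frame z0 v sg (x + r * complex.Re (w / v)) (y + r * (sg * complex.Im (w / v))).
Proof.
rewrite /frame -addrA; congr (_ + _).
have wE : w = v * (complex.Re (w / v) +i* complex.Im (w / v)).
  have -> : complex.Re (w / v) +i* complex.Im (w / v) = w / v by case: (_ / v).
  by rewrite mulrCA mulfV// mulr1.
rewrite {1}wE mulrCA -mulrDr; congr (_ * _).
case: (w / v) => a b /=; rewrite mulrDr [sg * (r * _)]mulrCA [sg * (sg * _)]mulrA sg2 mul1r.
by apply/eqP; rewrite eq_complex /=; apply/andP; split; apply/eqP; ring.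
Qed.

Lemma frame_coord x y : complex.Re ((frame z0 v sg x y - z0) / v) = x /\
  sg * complex.Im ((frame z0 v sg x y - z0) / v) = y.
Proof.
rewrite /frame addrC addKr mulrAC mulfV// mul1r /=; split=> //.
by rewrite mulrA sg2 mul1r.
Qed.

Lemma frame_coord_cvg x y :
  (fun w => complex.Re ((w - z0) / v)) @ frame z0 v sg x y --> x /\
  (fun w => sg * complex.Im ((w - z0) / v)) @ frame z0 v sg x y --> y.
Proof.
have cq : (fun w : R[i] => (w - z0) / v) @ frame z0 v sg x y -->
    (frame z0 v sg x y - z0) / v.
  exact: (cvgCM (cvgCD (cvgC_id _) (cvgC_cst (- z0))) (cvgC_cst v^-1)).
have /cvg_ReIm[cqx cqy] := cq; have [qx qy] := frame_coord x y.
split; first by rewrite qx in cqx.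
have cs : (fun=> sg) @ frame z0 v sg x y --> sg.
  exact: (@cst_continuous _ _ sg (frame z0 v sg x y)).
by rewrite -[X in _ --> X]qy; exact (cvgM cs cqy).
Qed.

Lemma frame_box_nbhs (e d : R) : 0 < e -> 0 < d ->
  nbhs z0 [set w | exists x y, [/\ `|x| < e, `|y| < d & w = frame z0 v sg x y]].
Proof.
move=> e0 d0; have [] := frame_coord_cvg 0 0.
have -> : frame z0 v sg 0 0 = z0 by rewrite /frame mulr0 mulr0 addr0.
move=> /cvg_norm/cvgr_lt cx /cvg_norm/cvgr_lt cy; rewrite normr0 in cx cy.
apply: filterS2 (cx _ e0) (cy _ d0) => w wx wy.
by do 2 eexists; split; [exact: wx|exact: wy|rewrite frameK].
Qed.

Lemma frame_near (U : set R[i]) : nbhs z0 U ->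
  exists2 e, 0 < e & forall x y, `|x| < e -> `|y| < e -> U (frame z0 v sg x y).
Proof.
move=> /nbhs_normcP[e e0 eU].
have K0 : 0 <= normc v * (1 + `|sg|) by rewrite mulr_ge0 ?normc_ge0// addr_ge0.
have [d d0 dK] := small_factor K0 e0.
exists d => // x y xd yd; apply: eU; rewrite /frame addrC addKr.
rewrite normcM; apply: le_lt_trans dK.
rewrite -mulrA ler_wpM2l ?normc_ge0//.
rewrite (le_trans (normc_le_ReIm _))//= mulrDl mul1r lerD//; first exact: ltW.
by rewrite normrM ler_wpM2l// ltW.
Qed.

End Frame.

Lemma dot_conjc {R : realType} (a h : R[i]) : dot (a^*)%C h = complex.Re (a * h).
Proof. by case: a h => [x y] [p q]; rewrite /dot /= mulNr. Qed.

Section LocalStructure.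
Context {R : realType}.
Variables (P Q : {poly R[i]}) (M : set R[i]) (J : set R) (c : R -> R[i]).
Variables (sg t0 : R).
Hypothesis sg2 : sg * sg = 1.
Hypotheses (Jopen : open J) (Jt0 : J t0) (cint : integral_curve P Q J c).
Hypothesis P_neq0 : forall t, J t -> P.[c t] != 0.
Hypothesis speed : forall t, J t -> ratfun P Q (c t) != 0.
Hypothesis turn : forall t, J t -> 0 < sg * complex.Im (dratfun P Q (c t)).
Hypothesis cM : forall t, J t -> M (c t).
Hypothesis ray_c : forall t r, J t -> 0 < r ->
  ~ M (c t + r%:C * ratfun P Q (c t)).
Hypothesis ray_inv : forall z r, P.[z] != 0 -> ~ M z -> 0 <= r ->
  ~ M (z + r%:C * ratfun P Q z).

Let z0 := c t0.
Let v := ratfun P Q z0.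
Let phi := frame z0 v sg.

Let v0 : v != 0. Proof. exact: speed. Qed.

Let C s := (c (t0 + s) - z0) / v.
Let W s := ratfun P Q (c (t0 + s)) / v.
Let X s := complex.Re (C s).
Let Y s := sg * complex.Im (C s).
Let X' s := complex.Re (W s).
Let Y' s := sg * complex.Im (W s).
Let W' s := dratfun P Q (c (t0 + s)) * W s.

Let phiC s : phi (X s) (Y s) = c (t0 + s). Proof. exact: frameK. Qed.

Let velC s : J (t0 + s) -> has_velocity C s (W s).
Proof.
move=> Js; have [_ /velocity_shift cv] := cint Js.
apply: velocity_eq (velocityM (velocityD cv (velocity_cst (- z0) s)) (velocity_cst v^-1 s)).
by rewrite addr0 mulr0 addr0.
Qed.

Let velW s : J (t0 + s) -> has_velocity W s (W' s).
Proof.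
move=> Js; have [np /velocity_shift cv] := cint Js.
apply: velocity_eq (velocityM (velocity_ratfun np cv) (velocity_cst v^-1 s)).
by rewrite mulr0 addr0 /W' /W mulrA.
Qed.

Let scaled (f : R -> R) (x d : R) : is_derive x (1 : R) f d ->
  is_derive x (1 : R) (fun x => sg * f x) (sg * d).
Proof.
move=> df; have dk : is_derive x (1 : R) (cst sg) 0 by exact: is_derive_cst.
by refine (is_derive_eq (is_deriveM dk df) _); rewrite /GRing.scale /= mulr0 addr0.
Qed.

Let turning s : J (t0 + s) -> W s != 0 ->
  0 < X' s * (sg * complex.Im (W' s)) - Y' s * complex.Re (W' s).
Proof.
move=> Js; rewrite /X' /Y' /W'; have := turn Js; move: (dratfun _ _ _) (W s) => k w k0 w0.
have -> : complex.Re w * (sg * complex.Im (k * w)) - sg * complex.Im w * complex.Re (k * w) =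
   sg * complex.Im k * (complex.Re w ^+ 2 + complex.Im w ^+ 2).
  by rewrite ImM ReM; ring.
by rewrite mulr_gt0// normc2_gt0.
Qed.

Let W0 : W 0 = 1. Proof. by rewrite /W addr0 divff. Qed.

Let window : exists2 tau, 0 < tau &
  forall s, `|s| < tau -> J (t0 + s) /\ 0 < X' s.
Proof.
have nJ : \forall s \near (0 : R), J (t0 + s).
  have : (fun s => t0 + s) @ (0 : R) --> t0 + 0.
    by apply: cvgD; [exact: cvg_cst|exact: cvg_id].
  by rewrite addr0; apply; exact: open_nbhs_nbhs.
have nX : \forall s \near (0 : R), 0 < X' s.
  have J0 : J (t0 + 0) by rewrite addr0.
  have X'c : X' @ (0 : R) --> X' 0 := is_derive_continuous (velW J0).1.
  by move/cvgr_gt : X'c; apply; rewrite /X' W0 ltr01.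
have /nbhs_ballP[tau tau0 tauP] : nbhs (0 : R) [set s | J (t0 + s) /\ 0 < X' s].
  exact: filterI nJ nX.
exists tau => // s st; apply: tauP; rewrite /ball /= sub0r normrN; exact: st.
Qed.

(** In the frame at [c t0] given by the velocity, the curve starts along the
    first axis and turns to the left: its velocity [W] satisfies
    [W' = R'(c) W], and [sg * Im (conj W * W') = |W|^2 * (sg * Im R')]. The last
    clause is strict convexity, with a normal vector [n] to the curve at each
    of its points. *)
Lemma local_arc_epigraph : exists tau e d g,
  [/\ [/\ 0 < e, 0 < d & forall x, `|x| < e -> {for x, continuous g}],
   forall s, `|s| < tau -> J (t0 + s),
   forall x, `|x| < e -> exists2 s, `|s| < tau & c (t0 + s) = phi x (g x),
   forall x y, `|x| < e -> `|y| < d -> (M (phi x y) <-> g x <= y) &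
   forall s, `|s| < tau -> exists2 n, n != 0 & forall t, `|t| < tau -> t != s ->
     0 < dot n (c (t0 + t) - c (t0 + s))].
Proof.
have [tau tau0 tauP] := window.
have tauJ s : `|s| < tau -> J (t0 + s) by move=> /tauP[].
have X'0 s : `|s| < tau -> 0 < X' s by move=> /tauP[].
have Wn0 s : `|s| < tau -> W s != 0.
  by move=> /tauJ Js; rewrite /W mulf_neq0 ?invr_eq0//; exact: speed.
have dXY (s : R) : `|s| < tau -> is_derive s (1 : R) X (X' s) /\ is_derive s (1 : R) Y (Y' s).
  by move=> /tauJ/velC[dX dY]; split=> //; exact: scaled.
have dXY' (s : R) : `|s| < tau -> is_derive s (1 : R) X' (complex.Re (W' s)) /\
    is_derive s (1 : R) Y' (sg * complex.Im (W' s)).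
  by move=> /tauJ/velW[dX dY]; split=> //; exact: scaled.
have [Xinc conv] := turning_arc_convex dXY dXY' X'0
  (fun s st => turning (tauJ s st) (Wn0 s st)).
pose V1 x y := complex.Re (ratfun P Q (phi x y) / v).
pose V2 x y := sg * complex.Im (ratfun P Q (phi x y) / v).
have ratc : (fun z => ratfun P Q z / v) @ z0 --> (1 : R[i]).
  rewrite -(divff v0); have [np _] := cint Jt0.
  by exact: (cvgCM (cvgCM (continuous_hornerC _ z0) (cvgCV np (continuous_hornerC _ z0)))
     (cvgC_cst v^-1)).
have [e [d [g [e0 d0 gc arc epi]]]] :
    exists e d (g : R -> R), [/\ 0 < e, 0 < d, forall x, `|x| < e -> {for x, continuous g},
      forall x, `|x| < e -> exists s, [/\ `|s| < tau, X s = x & Y s = g x]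
    & forall x y, `|x| < e -> `|y| < d -> (M (phi x y) <-> g x <= y)].
  apply: (@convex_arc_epigraph R (fun x y => M (phi x y)) X Y X' Y' V1 V2 tau) => //.
  - move=> s st; have [? ?] := dXY s st; have [? ?] := dXY' s st.
    by split; apply: is_derive_continuous; eassumption.
  - by rewrite /X /Y /Y' /C W0 addr0 subrr mul0r !mulr0.
  - by move=> s st; rewrite phiC; exact: cM (tauJ s st).
  - move=> s r st r0; have := ray_c (tauJ s st) r0.
    by rewrite -{1}phiC /phi (frame_step z0 v0 sg2).
  - have /(frame_near v sg)[d d0 dP] := continuous_hornerC P z0 _ (near_neq0 (P_neq0 Jt0)).
    exists d => // x y xd yd nM r r0; have := ray_inv (dP x y xd yd) nM r0.
    by rewrite /phi (frame_step z0 v0 sg2).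
  - move=> e e0.
    have : nbhs (1 : R[i]) [set z | normc (z - 1) < e] by apply/nbhs_normcP; exists e.
    move=> /ratc/(frame_near v sg)[d d0 dP]; exists d => // x y xd yd.
    have we := dP x y xd yd; split; apply: le_lt_trans we.
      by rewrite /V1 -[1](ReC 1) -ReN -ReD; exact: le_Re_normc.
    rewrite normrM (_ : `|sg| = 1) ?mul1r.
      have := le_Im_normc (ratfun P Q (frame z0 v sg x y) / v - 1).
      by rewrite ImD ImN ImC oppr0 addr0.
    apply/eqP; rewrite -(@eqrXn2 _ 2)// expr1n -normrX expr2 sg2 normr1 //.
exists tau, e, d, g; split=> //.
- by move=> x /arc[s [st <- <-]]; exists s => //; rewrite phiC.
(* Up to the coordinates, [dot n h] is the determinant of the velocity at [s]
   and of [h]. *)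
move=> s st; exists (((- Y' s -i* (sg * X' s)) / v)^*)%C.
  rewrite conjc_eq0 mulf_neq0 ?invr_eq0//.
  apply/eqP => /(congr1 (@complex.Im R)) /eqP; rewrite /= oppr_eq0 => /eqP sX'.
  have := X'0 s st; rewrite -[X' s]mul1r -sg2 -mulrA sX' mulr0 ltxx; exact.
move=> t tt ts; have := conv s t st tt; rewrite eq_sym => /(_ ts).
rewrite dot_conjc; set a := (_ -i* _).
have -> : a / v * (c (t0 + t) - c (t0 + s)) = a * (C t - C s) by rewrite /C; ring.
congr (0 < _).
by rewrite ReM ReD ImD ReN ImN /a /X /Y /=; ring.
Qed.

End LocalStructure.

(** * Iterated derivatives along a rational vector field *)

Section WeightedNorm.
Context {R : realType}.
Variable rho : R.
Hypothesis rho_ge1 : 1 <= rho.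
Implicit Types (g h : {poly R[i]}) (a z : R[i]).

Let rho0 : 0 <= rho. Proof. exact: le_trans ler01 rho_ge1. Qed.

(** The l1 norm of the coefficients, with weight [rho ^+ k] in degree [k]; it
    dominates the values on the disc of radius [rho]. *)
Definition pnorm g : R := \sum_(k < size g) normc g`_k * rho ^+ k.

Lemma pnorm_widen g m : (size g <= m)%N ->
  pnorm g = \sum_(k < m) normc g`_k * rho ^+ k.
Proof.
move=> gm; rewrite /pnorm (big_ord_widen m (fun k => normc g`_k * rho ^+ k) gm).
rewrite big_mkcond; apply: eq_bigr => k _; case: ltnP => // gk.
by rewrite nth_default// normc0 mul0r.
Qed.

Lemma pnorm_ge0 g : 0 <= pnorm g.
Proof. by apply: sumr_ge0 => k _; rewrite mulr_ge0 ?normc_ge0// exprn_ge0. Qed.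

Lemma pnorm0 : pnorm 0 = 0.
Proof. by rewrite /pnorm size_poly0 big_ord0. Qed.

Lemma pnormD g h : pnorm (g + h) <= pnorm g + pnorm h.
Proof.
set m := maxn (size g) (size h).
rewrite (@pnorm_widen g m) ?leq_maxl// (@pnorm_widen h m) ?leq_maxr//.
rewrite (@pnorm_widen _ m) ?(leq_trans (size_polyD _ _))// -big_split /=.
apply: ler_sum => k _; rewrite coefD -mulrDl ler_wpM2r ?exprn_ge0//.
exact: complex.le_normcD.
Qed.

Lemma pnormZ a g : pnorm (a *: g) = normc a * pnorm g.
Proof.
rewrite (@pnorm_widen _ (size g)) ?size_scale_leq// /pnorm mulr_sumr.
apply: eq_bigr => k _.
by rewrite coefZ normcM mulrA.
Qed.

Lemma pnormMXaddC g a : pnorm (g * 'X + a%:P) = rho * pnorm g + normc a.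
Proof.
rewrite (@pnorm_widen _ (size g).+1); last first.
  by rewrite size_MXaddC; case: ifP.
rewrite big_ord_recl coefD coefMX coefC /= add0r expr0 mulr1 addrC; congr (_ + _).
rewrite /pnorm mulr_sumr; apply: eq_bigr => k _.
by rewrite coefD coefMX coefC /= addr0 exprS; ring.
Qed.

Lemma pnormMX g : pnorm (g * 'X) = rho * pnorm g.
Proof.
have := pnormMXaddC g 0; rewrite addr0 normc0 addr0; exact.
Qed.

Lemma pnormM g h : pnorm (g * h) <= pnorm g * pnorm h.
Proof.
elim/poly_ind: g => [|g a IH]; first by rewrite mul0r pnorm0 mul0r.
rewrite pnormMXaddC mulrDl mulrAC mul_polyC (le_trans (pnormD _ _))// pnormMX.
by rewrite pnormZ mulrDl lerD2r -mulrA ler_wpM2l.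
Qed.

Lemma pnorm_deriv g : pnorm g^`() <= (size g)%:R * pnorm g.
Proof.
elim/poly_ind: g => [|g a IH]; first by rewrite deriv0 pnorm0 mulr0.
have [->|g0] := eqVneq g 0.
  by rewrite mul0r add0r derivC pnorm0 mulr_ge0 ?pnorm_ge0.
rewrite size_MXaddC (negPf g0) /= pnormMXaddC derivD derivM derivX derivC addr0 mulr1.
rewrite (le_trans (pnormD _ _))// pnormMX.
apply: (@le_trans _ _ ((size g).+1%:R * (rho * pnorm g))); last first.
  by rewrite ler_wpM2l// lerDl normc_ge0.
rewrite -natr1 mulrDl mul1r mulrCA lerD ?ler_wpM2l//.
by rewrite ler_peMl// pnorm_ge0.
Qed.

Lemma normc_horner_le g z : normc z <= rho -> normc g.[z] <= pnorm g.
Proof.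
move=> zr; elim/poly_ind: g => [|g a IH].
  by rewrite horner0 normc0 pnorm_ge0.
rewrite hornerMXaddC pnormMXaddC (le_trans (complex.le_normcD _ _))// lerD2r.
by rewrite normcM mulrC ler_pM// ?normc_ge0.
Qed.

Lemma pnormX : pnorm 'X = rho.
Proof.
have -> : 'X = 1%:P * 'X + 0%:P :> {poly R[i]} by rewrite addr0 mul1r.
rewrite pnormMXaddC /pnorm size_poly1 big_ord1 coefC expr0 mulr1.
by rewrite normc1 normc0 mulr1 addr0.
Qed.

End WeightedNorm.

Section FlowDerivatives.
Context {R : realType}.
Variables n d : {poly R[i]}.

(** The fractions [flow_num k / d ^+ k.*2] are the iterated images of the
    coordinate function under the derivation [(n / d) d/dz]; they give the
    successive derivatives of every integral curve of [n / d]. *)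
Fixpoint flow_num (k : nat) : {poly R[i]} :=
  if k is k'.+1 then
    n * ((flow_num k')^`() * d - (k'.*2)%:R *: (flow_num k' * d^`()))
  else 'X.

Definition flow_deriv (k : nat) (z : R[i]) : R[i] :=
  (flow_num k).[z] / d.[z] ^+ k.*2.

Lemma velocity_flow_deriv (c : R -> R[i]) (s : R) (k : nat) :
  d.[c s] != 0 -> has_velocity c s (n.[c s] / d.[c s]) ->
  has_velocity (fun s => flow_deriv k (c s)) s (flow_deriv k.+1 (c s)).
Proof.
move=> d0 cv; have dm0 : (d ^+ k.*2).[c s] != 0 by rewrite horner_exp expf_neq0.
have := velocity_rational (flow_num k) dm0 cv.
under eq_fun do rewrite horner_exp; apply: velocity_eq.
rewrite /flow_deriv deriv_exp /=; move: (flow_num k) => f.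
rewrite hornerMn !(hornerM, hornerD, hornerN, hornerZ) !horner_exp -mulr_natl.
case: k {dm0} => [|k]; first by rewrite !(doubleS, double0) /= !expr0 mulr0n; field.
rewrite !doubleS /= !exprS; have := expf_neq0 k.*2 d0.
by move: (d.[c s] ^+ k.*2) => E E0; field; rewrite E0.
Qed.

Lemma size_flow_num k : (size (flow_num k) <= 2 + k * (size n + size d))%N.
Proof.
elim: k => [|k IH]; first by rewrite size_polyX.
rewrite /= (leq_trans (size_polyMleq _ _))// -subn1 leq_subLR.
set f := flow_num k in IH *.
have sM (p q : {poly R[i]}) : (size (p * q)%R <= size p + size q)%N.
  by rewrite (leq_trans (size_polyMleq _ _))// leq_pred.
have sD (p : {poly R[i]}) : (size (p^`())%R <= size p)%N.
  have [->|p0] := eqVneq p 0%R; first by rewrite deriv0 size_poly0.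
  by rewrite ltnW// lt_size_deriv.
have sA : (size (f^`() * d - k.*2%:R *: (f * d^`()))%R <= size f + size d)%N.
  rewrite (leq_trans (size_polyD _ _))// geq_max size_polyN.
  rewrite (leq_trans (sM _ _)) ?leq_add//=.
  by rewrite (leq_trans (size_scale_leq _ _))// (leq_trans (sM _ _))// leq_add.
rewrite mulSn (leq_trans (leq_add (leqnn _) sA))// addnCA addnC -addnA add1n.
by rewrite leqW// addnA addnAC [leqRHS]addnCA addnAC leq_add2l.
Qed.

(** The factor contributed by step [k] is linear in [k], because the degree of
    [flow_num k] and the exponent [k.*2] are; the product of these factors is
    of the order of [K ^+ k * k`!]. *)
Lemma pnorm_flow_num (rho : R) : 1 <= rho -> exists2 K, 0 <= K &
  forall k, pnorm rho (flow_num k) <= rho * K ^+ k * k`!%:R.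
Proof.
move=> r1; pose e := (size n + size d)%N.
pose K := pnorm rho n * ((2 + e)%:R * pnorm rho d + 2 * pnorm rho d^`()).
have r0 : 0 <= rho by exact: le_trans ler01 r1.
have pn0 g : 0 <= pnorm rho g by exact: pnorm_ge0.
exists K; first by rewrite mulr_ge0// addr_ge0// mulr_ge0.
elim=> [|k IH]; first by rewrite pnormX// expr0 fact0 !mulr1.
rewrite exprS factS natrM.
have -> : rho * (K * K ^+ k) * (k.+1%:R * k`!%:R) = K * k.+1%:R * (rho * K ^+ k * k`!%:R).
  by ring.
have K0 : 0 <= K * k.+1%:R by rewrite mulr_ge0// mulr_ge0// addr_ge0// mulr_ge0.
apply: le_trans (ler_wpM2l K0 IH).
rewrite /= (le_trans (pnormM r1 _ _))// /K -!mulrA ler_wpM2l//.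
move: (flow_num k) (size_flow_num k) => f sf.
have sf' : (size f)%:R <= (2 + e)%:R * k.+1%:R :> R.
  rewrite -natrM ler_nat (leq_trans sf)// mulnS mulnDl -/e [(k * e)%N]mulnC.
  by rewrite leq_add ?leq_addr ?leq_addl.
rewrite (le_trans (pnormD r1 _ _))// -scaleNr pnormZ// mulrDl lerD//.
  have -> : (2 + e)%:R * pnorm rho d * (k.+1%:R * pnorm rho f) =
      (2 + e)%:R * k.+1%:R * pnorm rho f * pnorm rho d by ring.
  rewrite (le_trans (pnormM r1 _ _))// ler_wpM2r//.
  by rewrite (le_trans (pnorm_deriv r1 _))// ler_wpM2r.
have -> : normc (- k.*2%:R : R[i]) = k.*2%:R.
  by rewrite complex.normcN complex.normcMn normc1.
have -> : 2 * pnorm rho d^`() * (k.+1%:R * pnorm rho f) =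
    (2 * k.+1%:R) * (pnorm rho f * pnorm rho d^`()) by ring.
rewrite ler_pM ?pn0 ?pnormM//.
by rewrite -natrM ler_nat mul2n leq_double.
Qed.
End FlowDerivatives.

(** The mean value theorem is applied to the two coordinates separately, whence
    the factor 2. *)
Lemma velocity_bound {R : realType} (f f' : R -> R[i]) (a b B : R) :
  (forall s, `|s - a| <= `|b - a| -> `|b - s| <= `|b - a| ->
     has_velocity f s (f' s) /\ normc (f' s) <= B) ->
  normc (f b - f a) <= 2 * (B * `|b - a|).
Proof.
move=> fB.
have real_bound (g g' : R -> R) :
    (forall s, `|s - a| <= `|b - a| -> `|b - s| <= `|b - a| ->
      is_derive s (1 : R) g (g' s) /\ `|g' s| <= B) -> `|g b - g a| <= B * `|b - a|.
  move=> gB.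
  have [ab|ba|->] := ltgtP a b; last by rewrite !subrr normr0 mulr0.
  - have dg x : a <= x <= b -> is_derive x (1 : R) g (g' x) /\ `|g' x| <= B.
      move=> /andP[ax xb]; apply: gB.
        by rewrite !ger0_norm ?subr_ge0 ?(ltW ab)// lerD2r.
      by rewrite !ger0_norm ?subr_ge0 ?(ltW ab)// lerD2l lerN2.
    have [x /andP[ax xb] ->] := mean_value ab (fun x xab => (dg x xab).1).
    by rewrite normrM ler_wpM2r// (dg x _).2// !ltW.
  - have dg x : b <= x <= a -> is_derive x (1 : R) g (g' x) /\ `|g' x| <= B.
      move=> /andP[bx xa]; apply: gB.
        by rewrite !ler0_norm ?subr_le0 ?(ltW ba)// lerN2 lerD2r.
      by rewrite !ler0_norm ?subr_le0 ?(ltW ba)// lerN2 lerD2l lerN2.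
    have [x /andP[bx xa] e] := mean_value ba (fun x xab => (dg x xab).1).
    rewrite distrC e normrM [`|b - a|]distrC ler_wpM2r//.
    by apply: (dg x _).2; rewrite !ltW.
have Rb : `|complex.Re (f b) - complex.Re (f a)| <= B * `|b - a|.
  apply: (real_bound (fun s => complex.Re (f s)) (fun s => complex.Re (f' s))) => s sa bs.
  have [[dR _] fs] := fB s sa bs; split=> //; exact: le_trans (le_Re_normc _) fs.
have Ib : `|complex.Im (f b) - complex.Im (f a)| <= B * `|b - a|.
  apply: (real_bound (fun s => complex.Im (f s)) (fun s => complex.Im (f' s))) => s sa bs.
  have [[_ dI] fs] := fB s sa bs; split=> //; exact: le_trans (le_Im_normc _) fs.
rewrite (le_trans (normc_le_ReIm _))// ReD ReN ImD ImN mulr_natl mulr2n.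
exact: lerD.
Qed.

(** * Analyticity of integral curves *)

Lemma velocity_taylor_weight {R : realType} (t s : R) (k : nat) :
  has_velocity (fun s => ((t - s) ^+ k.+1 / (k.+1)`!%:R)%:C) s
    (- ((t - s) ^+ k / k`!%:R)%:C).
Proof.
split; last by rewrite /= oppr0; exact: is_derive_cst.
have dt : is_derive s (1 : R) (fun s => t - s) (-1).
  refine (is_derive_eq (is_deriveB (is_derive_cst t s 1) (is_derive_id s 1)) _).
  by rewrite sub0r.
have dk : is_derive s (1 : R) (cst ((k.+1)`!%:R^-1 : R)) 0 by exact: is_derive_cst.
have := is_deriveX k.+1 dt; rewrite exprfctE => dX.
refine (is_derive_eq (is_deriveM dX dk) _).
rewrite /GRing.scale /= mulr0 add0r factS natrM; field.
by rewrite nat1r !pnatr_eq0 -lt0n fact_gt0.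
Qed.

(** For fixed [t], the Taylor polynomial of order [m] at [s], evaluated at [t],
    is a curve [G m.+1] in the variable [s]. Its velocity telescopes to the
    single term [c^(m+1)(s) (t - s)^m / m!]; it starts at the Taylor polynomial
    at [t0] and ends at [c t]. The bound [rho * L ^+ k * k`!] on the
    derivatives then makes the remainder geometrically small. *)
Lemma flow_analytic {R : realType} (n d : {poly R[i]}) (J : set R) (c : R -> R[i]) (t0 : R) :
  open J -> (forall t, J t -> d.[c t] != 0 /\ has_velocity c t (n.[c t] / d.[c t])) ->
  J t0 -> real_analytic_at c t0.
Proof.
move=> Jopen cflow Jt0; have [d0 cv0] := cflow _ Jt0.
pose rho := normc (c t0) + 1.
have rho1 : 1 <= rho by rewrite lerDr normc_ge0.
have rho0 : 0 <= rho by exact: le_trans ler01 rho1.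
pose del := normc d.[c t0] / 2.
have nd0 : 0 < normc d.[c t0] by rewrite normc_gt0.
have del0 : 0 < del by rewrite divr_gt0.
have [tau tau0 tauP] : exists2 tau, 0 < tau & forall s, `|s - t0| < tau ->
    [/\ J s, normc (c s) <= rho & del <= normc d.[c s]].
  have n1 : \forall s \near t0, J s by exact: open_nbhs_nbhs.
  have cc := has_velocity_cvg cv0.
  have n2 : \forall s \near t0, normc (c s) <= rho.
    have : nbhs (c t0) [set w | normc w <= rho].
      apply/nbhs_normcP; exists 1 => // w w1; rewrite -[w](subrK (c t0)) addrC.
      by rewrite /= (le_trans (complex.le_normcD _ _))// lerD2l ltW.
    by move=> /cc.
  have n3 : \forall s \near t0, del <= normc d.[c s].
    have : nbhs d.[c t0] [set w | del <= normc w].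
      apply/nbhs_normcP; exists del => // w w1.
      have := complex.le_normcD (d.[c t0] - w) w.
      rewrite subrK -[normc (_ - w)]complex.normcN opprB.
      by move: w1; rewrite /= /del; lra.
    by move=> /(continuous_hornerC d (c t0) _)/cc.
  have /nbhs_ballP[tau tau0 tauP] : nbhs t0 [set s |
      [/\ J s, normc (c s) <= rho & del <= normc d.[c s]]].
    by apply: filterS3 n1 n2 n3.
  by exists tau => // s st; apply: tauP; rewrite /ball /= distrC.
have [K K0 Kb] := pnorm_flow_num n d rho1.
pose L := K / del ^+ 2.
have L0 : 0 <= L by rewrite divr_ge0// exprn_ge0// ltW.
have bound k s : `|s - t0| < tau -> normc (flow_deriv n d k (c s)) <= rho * L ^+ k * k`!%:R.
  move=> /tauP[_ cr dd]; rewrite /flow_deriv.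
  rewrite normcM normcV.
  have -> : normc (d.[c s] ^+ k.*2) = normc d.[c s] ^+ k.*2.
    by elim: (k.*2) => [|j IH]; rewrite ?normc1// !exprS normcM IH.
  have -> : rho * L ^+ k * k`!%:R = rho * K ^+ k * k`!%:R * (del ^+ k.*2)^-1.
    rewrite /L expr_div_n -exprM -mul2n; field; rewrite expf_neq0// gt_eqF//.
  have dk0 : 0 < del ^+ k.*2 by exact: exprn_gt0.
  rewrite ler_pM ?normc_ge0//.
  - by rewrite invr_ge0 exprn_ge0// normc_ge0.
  - exact: le_trans (normc_horner_le rho1 _ cr) (Kb k).
  rewrite lef_pV2 ?posrE ?exprn_gt0 ?(lt_le_trans del0 dd)//.
  by apply: lerXn2r => //; rewrite nnegrE ?normc_ge0 ?(ltW del0).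
clearbody L.
(* Of the two factors 1/2 of the ratio 1/4, one absorbs the factor
   [m.+1 <= 2 ^ m.+1] of the remainder and the other gives the convergence. *)
have [r r0 rL] : exists2 r, 0 < r & L * r < 1 / 4.
  by apply: small_factor => //; lra.
exists (fun k => flow_deriv n d k (c t0) / (k`!%:R)%:C).
have close : \forall t \near t0, `|t - t0| < Num.min tau r.
  have m0 : 0 < Num.min tau r by rewrite lt_min tau0.
  apply/nbhs_ballP; exists (Num.min tau r) => //= t; rewrite /ball /= distrC; exact.
apply: filterS close => t; rewrite lt_min => /andP[t_tau t_r].
pose E k s : R[i] := ((t - s) ^+ k / k`!%:R)%:C.
pose G m s := \sum_(k < m) flow_deriv n d k (c s) * E k s.
have velG m s : `|s - t0| < tau ->
    has_velocity (G m.+1) s (flow_deriv n d m.+1 (c s) * E m s).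
  move=> /tauP[/cflow[ds cvs] _ _]; elim: m => [|m IH].
    have -> : G 1%N = (fun s => flow_deriv n d 0 (c s) * 1).
      by apply/funext => x; rewrite /G big_ord1 /E expr0 fact0 divr1.
    apply: velocity_eq (velocityM (velocity_flow_deriv 0 ds cvs) (velocity_cst 1 s)).
    by rewrite /E expr0 fact0 divr1 mulr0 addr0.
  have -> : G m.+2 = (fun s => G m.+1 s + flow_deriv n d m.+1 (c s) * E m.+1 s).
    by apply/funext => x; rewrite /G big_ord_recr.
  apply: velocity_eq (velocityD IH (velocityM (velocity_flow_deriv m.+1 ds cvs)
    (velocity_taylor_weight t s m))).
  by rewrite -/(E m.+1 s) -/(E m s); ring.
have Gt m : G m.+1 t = c t.
  rewrite /G big_ord_recl big1 => [|k _].
    by rewrite addr0 /E expr0 fact0 divr1 mulr1 /flow_deriv /= expr0 divr1 hornerX.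
  by rewrite /E subrr expr0n mul0r mulr0.
have Gt0 m : G m t0 = series (fun k => flow_deriv n d k (c t0) / (k`!%:R)%:C *
    ((t - t0)%:C) ^+ k) m.
  rewrite /G /series /= big_mkord; apply: eq_bigr => k _.
  by rewrite /E rmorphM rmorphXn fmorphV; ring.
have err m : normc (G m.+1 t - G m.+1 t0) <= 2 * rho * (1 / 2) ^+ m.+1.
  pose B := rho * L ^+ m.+1 * (m.+1)`!%:R * (`|t - t0| ^+ m / m`!%:R).
  have h : normc (G m.+1 t - G m.+1 t0) <= 2 * (B * `|t - t0|).
    apply: (@velocity_bound _ (G m.+1)
      (fun s => flow_deriv n d m.+1 (c s) * E m s)) => s st0 ts.
    have stau := le_lt_trans st0 t_tau; split; first exact: velG.
    rewrite normcM /B ler_pM ?normc_ge0 ?bound//.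
    rewrite /E /= expr0n /= addr0 sqrtr_sqr normrM normrX normfV.
    rewrite [`|m`!%:R|]ger0_norm// ler_wpM2r ?invr_ge0//.
    by rewrite lerXn2r ?nnegrE.
  apply: le_trans h _.
  have -> : 2 * (B * `|t - t0|) = 2 * rho * (m.+1%:R * (L * `|t - t0|) ^+ m.+1).
    rewrite /B factS natrM exprMn !exprS; field.
    by rewrite pnatr_eq0 -lt0n fact_gt0.
  rewrite ler_wpM2l ?mulr_ge0//.
  have q4 : L * `|t - t0| <= 1 / 2 * (1 / 2).
    have := ler_wpM2l L0 (ltW t_r); lra.
  apply: (@le_trans _ _ (m.+1%:R * ((1 / 2) ^+ m.+1 * (1 / 2) ^+ m.+1))).
    by rewrite ler_wpM2l// -exprMn lerXn2r ?nnegrE ?mulr_ge0//; lra.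
  rewrite mulrA ler_piMl ?exprn_ge0//.
  rewrite div1r exprVn ler_pdivrMr ?exprn_gt0// mul1r -natrX ler_nat.
  by rewrite ltnW// ltn_expl.
move=> U /nbhs_normcP[e e0 eU].
have half0 : (fun m => 2 * rho * (1 / 2) ^+ m : R) @ \oo --> (0 : R).
  rewrite -[X in _ --> X](mulr0 (2 * rho)); apply: cvgM; first exact: cvg_cst.
  by apply: cvg_expr; rewrite ger0_norm; lra.
have small : \forall m \near \oo, 2 * rho * (1 / 2) ^+ m < e.
  by move/cvgr_lt : half0; apply.
have : \forall m \near \oo, U (G m t0); last first.
  by apply: filterS => m; rewrite Gt0.
apply: filterS2 small (nbhs_infty_gt 0) => m sm m0.
apply: eU; rewrite -(prednK m0) -[X in _ - X](Gt m.-1).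
by rewrite -complex.normcN opprB (le_lt_trans (err _))// prednK.
Qed.

(** * Arcs of local points *)

Lemma sign_constant_on_interval {R : realType} (J : set R) (f : R -> R) :
  is_interval J -> (forall t, J t -> {for t, continuous f}) ->
  (forall t, J t -> f t != 0) -> forall s t, J s -> J t -> 0 < f s -> 0 < f t.
Proof.
move=> Jint fc f0 s t Js Jt fs; rewrite lt0r f0//= leNgt; apply/negP => ft.
have fst : f s * f t < 0 by rewrite pmulr_rlt0.
have [st|ts|e] := ltgtP s t; last by move: fs; rewrite e ltNge (ltW ft).
  have [|x /andP[sx xt] fx] := zero_between (ltW st) _ fst.
    by move=> x sxt; apply: fc; exact: (Jint s t).
  by have := f0 x (Jint s t Js Jt x _); rewrite fx eqxx !ltW// => /(_ isT).
have [||x /andP[tx xs] fx] := zero_between (f := f) (ltW ts).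
- by move=> x sxt; apply: fc; exact: (Jint t s).
- by rewrite mulrC.
by have := f0 x (Jint t s Jt Js x _); rewrite fx eqxx !ltW// => /(_ isT).
Qed.

Section ArcOfLocalPoints.
Context {R : realType}.
Variables (P Q : {poly R[i]}) (M A : set R[i]).
Hypothesis P_neq0 : P != 0.
Hypothesis M_inv : TCH_invariant P Q M.
Hypothesis A_local : arc_of_local_points P Q M A.

Lemma arc_regular z : A z ->
  [/\ M z, P.[z] != 0, ratfun P Q z != 0 & complex.Im (dratfun P Q z) != 0].
Proof.
have [_ _ Aloc] := A_local; have [Mcl _] := M_inv.
move=> Az; have [[clz _] nz _ _] := Aloc z Az.
have PQz : (P * Q).[z] != 0 by apply/negP => PQ0; apply: nz; left.
move: (PQz); rewrite hornerM mulf_eq0 negb_or => /andP[Pz Qz].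
split=> //.
- by have := clz; rewrite -(closure_id M).1.
- by rewrite ratfunE// mulf_neq0// invr_eq0.
apply/eqP => Im0; apply: nz; right; apply: subset_closure.
by have np := not_pole Q Pz; split=> //; rewrite derive1_ratfun.
Qed.

Lemma arc_outside z e : A z -> 0 < e -> exists2 w, normc (w - z) < e & ~ M w.
Proof.
have [_ Abd _] := A_local; move=> /Abd[_ intz] e0; apply: contrapT => nw.
apply: intz; apply/nbhs_normcP; exists e => // w we.
by apply: contrapT => Mw; apply: nw; exists w.
Qed.

(** This is what the emptiness of [Delta] says about the points at finite
    distance of the ray. *)
Lemma arc_ray z r : A z -> 0 < r -> ~ M (z + r%:C * ratfun P Q z).
Proof.
have [_ _ Aloc] := A_local; move=> Az r0 Mr.
have [_ _ v0 _] := arc_regular Az; have [_ _ _ Dz] := Aloc z Az.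
have : Delta P Q M z (finite_point (z + r%:C * ratfun P Q z)).
  split; last by apply: subset_closure; exists (z + r%:C * ratfun P Q z).
  split.
    apply: subset_closure; exists (z + r%:C * ratfun P Q z) => //.
    by exists r => //=; exact: ltW.
  move=> [] /(congr1 (fun w => w - z)) /eqP.
  rewrite addrC addKr subrr mulf_eq0 (negPf v0) orbF.
  by rewrite eq_complex /= eqxx andbT gt_eqF.
by rewrite Dz.
Qed.

Lemma arc_ray_inv z r : P.[z] != 0 -> ~ M z -> 0 <= r ->
  ~ M (z + r%:C * ratfun P Q z).
Proof.
apply: ray_misses_invariant => //.
have [[J [c [[[t Jt] _ _] _ _ AE]]] _ _] := A_local.
have Act : A (c t) by rewrite AE; exists t.
have [_ Pz _ I0] := arc_regular Act.
by exists (c t) => //; exact: not_pole.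
Qed.

(** A point of [A] in the box cannot be above the graph: it would have a
    neighbourhood above the graph, hence in [M], although it is a boundary
    point. So the box cuts [A] along the graph, even if [A] comes back near
    [z0]. *)
Lemma arc_local_structure (sg : R) : sg * sg = 1 ->
  (forall z, A z -> 0 < sg * complex.Im (dratfun P Q z)) ->
  forall z0, A z0 -> let phi := frame z0 (ratfun P Q z0) sg in
  exists e d (g : R -> R), [/\ 0 < e, 0 < d,
    forall x, `|x| < e -> {for x, continuous g},
    forall x y, `|x| < e -> `|y| < d ->
      (A (phi x y) <-> y = g x) /\ (M (phi x y) <-> g x <= y)
  & strictly_convex_curve (A `&` [set z | exists x y,
      [/\ `|x| < e, `|y| < d & z = phi x y]])].
Proof.
move=> sg2 turn z0 Az0 phi.
have [[J [c [[Jne Jo Ji] cint cinj AE]]] Abd Aloc] := A_local.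
have Ac t : J t -> A (c t) by move=> Jt; rewrite AE; exists t.
have : A z0 by []. rewrite {1}AE => -[t0 Jt0 ct0].
have [tau [e [d [g [[e0 d0 gc] tauJ arc epi conv]]]]] :=
  @local_arc_epigraph R P Q M J c sg t0 sg2 Jo Jt0 cint
    (fun t Jt => let: And4 _ Pz _ _ := arc_regular (Ac t Jt) in Pz)
    (fun t Jt => let: And4 _ _ v _ := arc_regular (Ac t Jt) in v)
    (fun t Jt => turn _ (Ac t Jt))
    (fun t Jt => let: And4 m _ _ _ := arc_regular (Ac t Jt) in m)
    (fun t r Jt => arc_ray (Ac t Jt)) arc_ray_inv.
rewrite ct0 -/phi in arc epi.
have v0 : ratfun P Q z0 != 0 by have [] := arc_regular Az0.
have on_graph x y : `|x| < e -> `|y| < d -> A (phi x y) -> y = g x.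
  move=> xe yd Axy; have [Mxy _ _ _] := arc_regular Axy.
  have gxy : g x <= y by apply/epi.
  apply/eqP; rewrite eq_le gxy andbT leNgt; apply/negP => gy.
  pose q w := (w - z0) / ratfun P Q z0.
  have [cqx cqy] := frame_coord_cvg z0 v0 sg2 x y.
  have gq : (fun w => g (complex.Re (q w))) @ phi x y --> g x.
    exact (cvg_comp _ _ cqx (gc x xe)).
  have nx : \forall w \near phi x y, `|complex.Re (q w)| < e.
    by move/cvg_norm/cvgr_lt : cqx; apply.
  have ny : \forall w \near phi x y, `|sg * complex.Im (q w)| < d.
    by move/cvg_norm/cvgr_lt : (cqy); apply.
  have ng : \forall w \near phi x y, g (complex.Re (q w)) - sg * complex.Im (q w) < 0.
    have gy0 : g x - y < 0 by rewrite subr_lt0.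
    have : (fun w => g (complex.Re (q w)) - sg * complex.Im (q w)) @ phi x y --> g x - y.
      exact (cvgB gq cqy).
    by move=> /cvgr_lt; apply.
  have /nbhs_normcP[r r0 rM] : nbhs (phi x y) M.
    apply: filterS3 nx ny ng => w wx wy wg.
    rewrite -(frameK z0 v0 sg2 w); apply/epi => //.
    by rewrite -subr_le0 ltW.
  by have [w wr] := arc_outside Axy r0; apply; exact: rM.
exists e, d, g; split=> //.
  move=> x y xe yd; split; last exact: epi.
  split; first exact: on_graph.
  move=> ->; have [s st <-] := arc x xe; exact: Ac (tauJ s st).
move=> p [Ap [x [y [xe yd pE]]]].
have yE : y = g x by apply: on_graph; rewrite // -pE.
have [s st cs] := arc x xe; rewrite -yE -pE in cs.
have [n n0 nP] := conv s st; exists n => // q [Aq [x' [y' [xe' yd' qE]]]] qp.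
have yE' : y' = g x' by apply: on_graph; rewrite // -qE.
have [t tt ct] := arc x' xe'; rewrite -yE' -qE in ct.
rewrite -cs -ct; apply: nP => //; apply: contra_neq qp => ts.
by rewrite -cs -ct ts.
Qed.

Lemma arc_analytic : real_analytic_curve A.
Proof.
have [[J [c [Joi cint cinj AE]]] _ _] := A_local.
have [_ Jo _] := Joi; exists J, c; split=> // t Jt.
have [np cv] := cint t Jt; split.
  by apply: (@flow_analytic R (Q %/ gcdp P Q) (P %/ gcdp P Q) J) => // s /cint.
have Act : A (c t) by rewrite AE; exists t.
by exists (ratfun P Q (c t)) => //; have [] := arc_regular Act.
Qed.

Lemma arc_turning_sign : exists2 sg : R, sg = 1 \/ sg = -1 &
  forall z, A z -> 0 < sg * complex.Im (dratfun P Q z).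
Proof.
have [[J [c [[[t0 Jt0] Jo Ji] cint _ AE]]] _ _] := A_local.
have Ac t : J t -> A (c t) by move=> Jt; rewrite AE; exists t.
pose f t := complex.Im (dratfun P Q (c t)).
have f0 t : J t -> f t != 0 by move=> /Ac/arc_regular[].
have fc t : J t -> {for t, continuous f}.
  move=> /cint[np /has_velocity_cvg cc].
  have : (fun z => dratfun P Q z) @ c t --> dratfun P Q (c t).
    have h p := continuous_hornerC p (c t).
    have d2 : (P %/ gcdp P Q).[c t] ^+ 2 != 0 by rewrite expf_neq0.
    rewrite /dratfun expr2; rewrite expr2 in d2.
    exact (cvgCM (cvgCD (cvgCM (h _) (h _)) (cvgCN (cvgCM (h _) (h _))))
      (cvgCV d2 (cvgCM (h _) (h _)))).
  by move=> /(cvg_comp _ _ cc)/cvg_ReIm[].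
have := f0 t0 Jt0; rewrite neq_lt => /orP[ft0|ft0].
  exists (-1); first by right.
  move=> z; rewrite AE => -[t Jt <-]; rewrite mulN1r.
  apply: (@sign_constant_on_interval _ J (fun t => - f t) Ji _ _ t0) => //.
  - by move=> s /fc; exact: cvgN.
  - by move=> s /f0; rewrite oppr_eq0.
  - by rewrite oppr_gt0.
exists 1; first by left.
move=> z; rewrite AE => -[t Jt <-]; rewrite mul1r.
exact: (@sign_constant_on_interval _ J f Ji _ _ t0).
Qed.

(** For [sg = -1] the tangent field is [- R], and the frame that it gives is
    the reflected frame with its first axis reversed. *)
Lemma arc_convex_oriented (sg : R) : sg = 1 \/ sg = -1 ->
  (forall z, A z -> 0 < sg * complex.Im (dratfun P Q z)) ->
  locally_strictly_convex_curve A /\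
  has_on_left M A (fun z => sg%:C * ratfun P Q z).
Proof.
move=> sg1 turn; have sg2 : sg * sg = 1 by case: sg1 => ->; rewrite ?mulrNN mul1r.
split=> z Az; have [e [d [g [e0 d0 gc epi conv]]]] := arc_local_structure sg2 turn Az.
  exists [set w | exists x y,
    [/\ `|x| < e, `|y| < d & w = frame z (ratfun P Q z) sg x y]] => //.
  have [_ _ v0 _] := arc_regular Az.
  exact: frame_box_nbhs.
have sgn x : `|sg * x| = `|x|.
  by rewrite normrM; case: sg1 => ->; rewrite ?normrN normr1 mul1r.
exists e, d, (fun x => g (sg * x)); split=> //.
  move=> x xe; have gsx := gc (sg * x); rewrite sgn in gsx.
  have csx : (fun x => sg * x) @ x --> sg * x.
    by apply: cvgM; [exact: cvg_cst|exact: cvg_id].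
  exact (cvg_comp _ _ csx (gsx xe)).
move=> x y xe yd /=.
have -> : z + sg%:C * ratfun P Q z * (x +i* y) = frame z (ratfun P Q z) sg (sg * x) y.
  rewrite /frame [sg%:C * _]mulrC -mulrA; congr (_ + _ * _).
  by apply/eqP; rewrite eq_complex /=; apply/andP; split; apply/eqP; ring.
by apply: epi; rewrite ?sgn.
Qed.

End ArcOfLocalPoints.

Theorem proposition4p11 (R : realType) (P Q : {poly R[i]}) (M A : set R[i])
    (P_neq0 : P != 0) (Q_neq0 : Q != 0)
    (PQ_nonconst : ~ ((size P <= 1)%N /\ (size Q <= 1)%N))
    (M_minimal : minimal_TCH_invariant P Q M)
    (M_int : interior M !=set0)
    (A_local : local_arc P Q M A) :
  [/\ real_analytic_curve A,
      locally_strictly_convex_curve A,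
      A `<=` inflection_pos P Q -> has_on_left M A (ratfun P Q)
    & ~ (A `<=` inflection_pos P Q) ->
        has_on_left M A (fun z => - ratfun P Q z)].
Proof.
have [M_inv _ _] := M_minimal; have [arcA _] := A_local.
have [sg sg1 turn] := arc_turning_sign M_inv arcA.
have [convA leftA] := arc_convex_oriented P_neq0 M_inv arcA sg1 turn.
have [[J [c [[[t Jt] _ _] _ _ AE]]] _ _] := arcA.
have Act : A (c t) by rewrite AE; exists t.
have npA z : A z -> ~~ pole P Q z.
  by move=> /(arc_regular M_inv arcA)[_ Pz _ _]; exact: not_pole.
split=> //; first exact: (arc_analytic M_inv arcA).
  move=> /(_ _ Act)[_]; rewrite derive1_ratfun ?npA// => Ipos.
  case: sg1 turn leftA => -> turn.
    by under eq_fun do rewrite mul1r.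
  by have := turn _ Act; rewrite mulN1r oppr_gt0 ltNge ltW.
case: sg1 turn leftA => -> turn.
  move=> _; case=> z Az; split; first exact: npA.
  by rewrite derive1_ratfun ?npA//; have := turn z Az; rewrite mul1r.
by under eq_fun do rewrite rmorphN rmorph1 mulN1r.
Qed.
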